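(* Let $N\ge2$ be a fixed integer. For even integers $n=2,4,6,\ldots$, as $n\to\infty$, $$\sum_{l=1}^{n-1}(-1)^{l+1}\csc\frac{\pi l}{n}=\frac{2n\ln2}{\pi}+2\sum_{r=1}^{N-1}\frac{(-1)^{r+1}(2^{2r-1}-1)(2^{2r}-1)\pi^{2r-1}B_{2r}^2}{r\,(2r)!\,n^{2r-1}}+O(n^{1-2N}).$$ In particular, the first terms of this asymptotic expansion are $$\frac{2n\ln2}{\pi}+\frac{\pi}{12n}-\frac{7\pi^3}{1440n^3}+\frac{31\pi^5}{30240n^5}-\frac{2159\pi^7}{4838400n^7}+\cdots.$$ If $n\geq 3$ is odd, then $\sum_{l=1}^{n-1}(-1)^{l+1}\csc\frac{\pi l}{n}=0$.
   Context: $B_m$ are the Bernoulli numbers, defined by $\frac{z}{e^z-1}=\sum_{m\ge0}\frac{B_m}{m!}z^m$ ($B_2=1/6$, $B_4=-1/30$, $B_6=1/42$, etc.). *)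

(* Defs.v *)
(* Stdlib real numbers with Coquelicot. *)
From Stdlib Require Import Reals Lra Lia Psatz ZArith Arith.
From Coquelicot Require Import Coquelicot.

Open Scope R_scope.

(* The quotient is z / (e^z - 1) only for z <> 0, hence the punctured
   neighbourhood [locally'].  The condition determines [B] uniquely;
   [bernoulli_numbers_exist] below shows that it is satisfiable. *)
Definition bernoulli_numbers (B : nat -> R) : Prop :=
  locally' 0 (fun z : R =>
    is_pseries (fun m => B m / INR (fact m)) z (z / (exp z - 1))).

Definition csc (x : R) : R := / sin x.

Definition alt_csc_sum (n : nat) : R :=
  sum_n_m (fun l => (-1) ^ (l + 1) * csc (PI * INR l / INR n)) 1 (n - 1).

(* Only used for r >= 1, so that [2 * r - 1] is not truncated. *)
Definition csc_term (B : nat -> R) (n r : nat) : R :=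
  (-1) ^ (r + 1) * (2 ^ (2 * r - 1) - 1) * (2 ^ (2 * r) - 1)
    * PI ^ (2 * r - 1) * (B (2 * r)%nat) ^ 2
  / (INR r * INR (fact (2 * r)) * INR n ^ (2 * r - 1)).

Definition csc_expansion (B : nat -> R) (N n : nat) : R :=
  2 * INR n * ln 2 / PI + 2 * sum_n_m (csc_term B n) 1 (N - 1).

(* f(n) = O(g(n)) as n tends to infinity through the even integers. *)
Definition bigO_even (f g : nat -> R) : Prop :=
  exists C : R,
    eventually (fun n => Nat.Even n -> Rabs (f n) <= C * Rabs (g n)).

(* bern_aux n k is B_k / k! for k <= n, obtained by solving
   (sum_k b_k z^k) * (sum_k z^k / (k+1)!) = 1 for the b_k in turn. *)
Fixpoint bern_aux (n : nat) : nat -> R :=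
  match n with
  | O => fun _ => 1
  | S m => fun k =>
      if Nat.leb k m then bern_aux m k
      else - sum_f_R0 (fun j => bern_aux m j * / INR (fact (S (S m - j)))) m
  end.

Lemma bern_aux_stable (n k : nat) : (k <= n)%nat -> bern_aux n k = bern_aux k k.
Proof.
induction n as [|n IH]; intros H.
- now replace k with 0%nat by lia.
- destruct (Nat.eq_dec k (S n)) as [->|Hk]; [reflexivity|].
  simpl. destruct (Nat.leb_spec k n); [apply IH; lia | lia].
Qed.

Lemma bern_aux_rec (m : nat) :
  bern_aux (S m) (S m) =
  - sum_f_R0 (fun j => bern_aux j j * / INR (fact (S (S m - j)))) m.
Proof.
cbn [bern_aux]. destruct (Nat.leb_spec (S m) m); [lia|].
f_equal. apply sum_eq. intros i Hi. now rewrite (bern_aux_stable m i Hi).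
Qed.

Lemma inv_fact_le (i : nat) : 0 < / INR (fact (S i)) <= (1 / 2) ^ i.
Proof.
induction i as [|i IH]; [simpl; lra|].
rewrite fact_simpl, mult_INR, Rinv_mult. simpl pow.
assert (H : 0 < / INR (S (S i)) <= 1 / 2).
{ assert (2 <= INR (S (S i))) by (rewrite !S_INR; pose proof (pos_INR i); lra).
  split; [apply Rinv_0_lt_compat; lra|].
  unfold Rdiv; rewrite Rmult_1_l. apply Rinv_le_contravar; lra. }
split; [apply Rmult_lt_0_compat; lra|].
apply Rmult_le_compat; lra.
Qed.

Lemma half_sum_le (n : nat) : sum_f_R0 (fun j => (1 / 2) ^ (S n - j)) n <= 1.
Proof.
induction n as [|n IH]; [cbn [sum_f_R0 Nat.sub pow]; lra|].
rewrite tech5. replace (S (S n) - S n)%nat with 1%nat by lia.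
rewrite (sum_eq _ (fun j => (1 / 2) ^ (S n - j) * (1 / 2))).
- rewrite <- scal_sum. rewrite pow_1. lra.
- intros i Hi. replace (S (S n) - i)%nat with (S (S n - i)) by lia. rewrite <- tech_pow_Rmult. ring.
Qed.

Lemma bern_aux_bound (n : nat) : Rabs (bern_aux n n) <= 1.
Proof.
induction n as [n IH] using lt_wf_ind. destruct n as [|m].
- simpl. rewrite Rabs_R1. lra.
- rewrite bern_aux_rec, Rabs_Ropp.
  eapply Rle_trans; [apply Rsum_abs|].
  eapply Rle_trans; [|apply (half_sum_le m)].
  apply sum_Rle. intros i Hi. rewrite Rabs_mult.
  pose proof (inv_fact_le (S m - i)) as H.
  rewrite (Rabs_pos_eq (/ _)) by lra.
  rewrite <- (Rmult_1_l ((1 / 2) ^ _)).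
  apply Rmult_le_compat; [apply Rabs_pos | lra | apply IH; lia | lra].
Qed.

Lemma CV_radius_ge_1 (a : nat -> R) :
  (forall n, Rabs (a n) <= 1) -> Rbar_le 1 (CV_radius a).
Proof.
intros H. apply (proj1 (CV_radius_bounded a)).
exists 1. intros n. rewrite pow1, Rmult_1_r. apply H.
Qed.

Lemma bernoulli_numbers_exist : exists B : nat -> R, bernoulli_numbers B.
Proof.
set (b := fun n => bern_aux n n).
set (e := fun k => / INR (fact (S k))).
exists (fun m => b m * INR (fact m)).
exists (mkposreal 1 Rlt_0_1). intros z Hz Hz0.
assert (Hz1 : Rabs z < 1).
{ revert Hz. unfold ball; simpl; unfold AbsRing_ball, abs, minus, plus, opp; simpl.
  now rewrite Ropp_0, Rplus_0_r. }
apply is_pseries_ext with b.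
{ intros n. unfold Rdiv. rewrite Rmult_assoc, Rinv_r; [symmetry; apply Rmult_1_r|apply INR_fact_neq_0]. }
assert (Rb : Rbar_lt (Rabs z) (CV_radius b)).
{ apply Rbar_lt_le_trans with 1; [exact Hz1 | apply CV_radius_ge_1, bern_aux_bound]. }
assert (Re : Rbar_lt (Rabs z) (CV_radius e)).
{ apply Rbar_lt_le_trans with 1; [exact Hz1 | apply CV_radius_ge_1].
  intros n. unfold e. pose proof (inv_fact_le n).
  rewrite Rabs_pos_eq by lra. apply Rle_trans with ((1 / 2) ^ n); [lra|].
  apply Rle_trans with (1 ^ n); [apply pow_incr; lra | rewrite pow1; lra]. }
pose proof (PSeries_correct b z (CV_radius_inside b z Rb)) as Sb.
pose proof (PSeries_correct e z (CV_radius_inside e z Re)) as Se.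
assert (Ee : z * PSeries e z = exp z - 1).
{ rewrite exp_Reals, (PSeries_decr_1 (fun n => / INR (fact n))).
  - change (PS_decr_1 (fun n => / INR (fact n))) with e.
    simpl fact. simpl INR. rewrite Rinv_1. ring.
  - eexists; apply is_exp_Reals. }
assert (Eb : PSeries b z * PSeries e z = 1).
{ rewrite <- PSeries_mult by assumption.
  rewrite (PSeries_ext _ (fun n => match n with O => 1 | S _ => 0 end)).
  - rewrite PSeries_decr_1.
    + rewrite (PSeries_ext _ (fun _ => 0)) by reflexivity.
      rewrite PSeries_const_0. ring.
    + apply CV_radius_inside.
      apply Rbar_lt_le_trans with 1; [exact Hz1 | apply CV_radius_ge_1].
      intros [|n]; rewrite ?Rabs_R1, ?Rabs_R0; lra.
  - intros [|n]; unfold PS_mult.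
    + unfold b, e. simpl. lra.
    + rewrite tech5, Nat.sub_diag.
      unfold b at 2. rewrite bern_aux_rec.
      unfold b, e. simpl (INR (fact 1)). rewrite Rinv_1. ring. }
assert (He : exp z - 1 <> 0).
{ rewrite <- Ee. apply Rmult_integral_contrapositive_currified; [exact Hz0|].
  intros H. rewrite H in Eb. lra. }
replace (z / (exp z - 1)) with (PSeries b z); [exact Sb|].
assert (PSeries e z <> 0) by (intros H; rewrite H in Eb; lra).
rewrite <- Ee.
apply Rmult_eq_reg_r with (PSeries e z); [|assumption].
rewrite Eb. field. split; assumption.
Qed.

(* Main.v *)
(* For even [n = 2 m] and [h = PI / n], reflection [x -> PI - x] reduces the sum to
   half-weighted alternating sums over [l <= m], i.e. to alternating sums of
   increments of [csc].  Write [csc x = / x + g x] with [g] smooth on (-PI, PI).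
   Boole's formula, with coefficients [t k] given by [tanh (z / 2) = sum t k z^k],
   replaces each alternating sum of increments by its boundary terms
   [sum_k t k h^k f^(k)] at both ends.  The [/ x] part contributes [2 n ln 2 / PI]
   and boundary terms at [PI / 2]; these cancel against those of [g], because the
   odd derivatives of [csc] vanish at [PI / 2].  What remains are the boundary terms
   of [g] at [0]: both [t] and the Taylor coefficients of [csc] are Bernoulli
   numbers up to elementary factors, hence the squares [B_(2r)^2]. *)

Require Import Defs.
From Stdlib Require Import Reals ZArith Arith Lra Lia.
From Coquelicot Require Import Coquelicot.

Open Scope R_scope.

(** * Finite sums *)

(** The obstacle is the pole at [0], only one step away from the first node. There the [K]-th
    derivative of [/ x] has size h^(-K-1), so Boole's formula applied to [csc] itself has an error
    bound of order h^K * h^(-K-1) = 1 / h, as large as the leading term. The [/ x] part is therefore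
    rescaled by homogeneity to unit step and compared with its limit at infinity, known from the
    alternating harmonic series, instead of with boundary terms at the first node. Its error then
    comes only from the tail past the last node, where derivatives are small. The regular part
    vanishes at [0], so its sum may start at [0] itself.

    All coefficient identities come from real power series identities near [0] and uniqueness of
    coefficients. The passage from sinh to sin takes place in the variable w = z^2, which avoids
    complex arguments.

    The boundary terms are kept up to order [2 * N - 1]. This yields [N] terms of the expansion, one
    more than needed; the last has size n^(1-2N) and is absorbed in the error. *)

Fixpoint psum (f : nat -> R) (n : nat) : R :=
  match n with O => 0 | S k => psum f k + f k end.

Lemma psum_ext (f g : nat -> R) (n : nat) :
  (forall k, (k < n)%nat -> f k = g k) -> psum f n = psum g n.
Proof.
induction n as [|n IH]; intros H; [reflexivity|]. simpl.
rewrite IH by (intros; apply H; lia). now rewrite H by lia.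
Qed.

Lemma psum_lin (a b : R) (f g : nat -> R) (n : nat) :
  psum (fun k => a * f k + b * g k) n = a * psum f n + b * psum g n.
Proof. induction n as [|n IH]; simpl; [ring | rewrite IH; ring]. Qed.

Lemma psum_scal (a : R) (f : nat -> R) (n : nat) :
  psum (fun k => a * f k) n = a * psum f n.
Proof. induction n as [|n IH]; simpl; [ring | rewrite IH; ring]. Qed.

Lemma psum_abs_le (f g : nat -> R) (n : nat) :
  (forall k, (k < n)%nat -> Rabs (f k) <= g k) -> Rabs (psum f n) <= psum g n.
Proof.
induction n as [|n IH]; intros H; simpl; [rewrite Rabs_R0; lra|].
eapply Rle_trans; [apply Rabs_triang|].
apply Rplus_le_compat; [apply IH; intros; apply H | apply H]; lia.
Qed.

Lemma psum_head (f : nat -> R) (n : nat) :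
  psum f (S n) = f 0%nat + psum (fun k => f (S k)) n.
Proof.
induction n as [|n IH]; [simpl; ring|].
change (psum f (S (S n))) with (psum f (S n) + f (S n)). rewrite IH. simpl; ring.
Qed.

Lemma psum_pairs (f : nat -> R) (n : nat) :
  psum f (2 * n) = psum (fun k => f (2 * k)%nat + f (2 * k + 1)%nat) n.
Proof.
induction n as [|n IH]; [reflexivity|].
replace (2 * S n)%nat with (S (S (2 * n))) by lia. cbn [psum]. rewrite IH.
replace (S (2 * n)) with (2 * n + 1)%nat by lia. ring.
Qed.

Lemma psum_triangle (F : nat -> nat -> R) (n : nat) :
  psum (fun k => psum (F k) (n - k)) n
  = psum (fun s => psum (fun k => F k (s - k)%nat) (S s)) n.
Proof.
induction n as [|n IH]; [reflexivity|].
change (psum (fun k => psum (F k) (S n - k)) n + psum (F n) (S n - n)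
  = psum (fun s => psum (fun k => F k (s - k)%nat) (S s)) n
    + (psum (fun k => F k (n - k)%nat) n + F n (n - n)%nat)).
rewrite <- IH. replace (S n - n)%nat with 1%nat by lia. rewrite Nat.sub_diag.
rewrite (psum_ext (fun k => psum (F k) (S n - k))
  (fun k => 1 * psum (F k) (n - k) + 1 * F k (n - k)%nat)).
- rewrite psum_lin. simpl. ring.
- intros k Hk. replace (S n - k)%nat with (S (n - k)) by lia. simpl. ring.
Qed.

Lemma psum_reverse (f : nat -> R) (n : nat) :
  psum f n = psum (fun k => f (n - S k)%nat) n.
Proof.
induction n as [|n IH]; [reflexivity|].
rewrite (psum_head (fun k => f (S n - S k)%nat)). cbn [psum]. rewrite IH at 1.
replace (S n - 1)%nat with n by lia. rewrite Rplus_comm. reflexivity.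
Qed.

Lemma psum_sum_f_R0 (f : nat -> R) (n : nat) : sum_f_R0 f n = psum f (S n).
Proof. induction n as [|n IH]; simpl in *; [ring | now rewrite IH]. Qed.

Lemma psum_sum_n_m (f : nat -> R) (n : nat) :
  sum_n_m f 1 n = psum (fun k => f (S k)) n.
Proof.
induction n as [|n IH].
- rewrite sum_n_m_zero by lia. reflexivity.
- rewrite sum_n_Sm by lia. rewrite IH. reflexivity.
Qed.

(** Peeling one term off each end leaves a sequence symmetric about the same middle, so the
    induction runs on the half-length; the middle term stays unpaired. *)
Lemma psum_fold (v : nat -> R) (j : nat) :
  (forall i, (i <= 2 * j)%nat -> v i = v (2 * j - i)%nat) ->
  psum v (S (2 * j)) = v j + 2 * psum v j.
Proof.
revert v; induction j as [|j IH]; intros v Hv; [simpl; ring|].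
replace (S (2 * S j)) with (S (S (S (2 * j)))) by lia.
change (psum v (S (S (S (2 * j))))) with (psum v (S (S (2 * j))) + v (S (S (2 * j)))).
rewrite psum_head, IH, (psum_head v j).
- replace (S (S (2 * j))) with (2 * S j - 0)%nat by lia.
  rewrite <- (Hv 0%nat) by lia. ring.
- intros i Hi. rewrite Hv by lia. f_equal. lia.
Qed.

(** * Smooth functions *)

(** Derivatives are carried as witnesses rather than through [Derive], so that closure under sums,
    products and inverses is a plain induction. [Cn_Derive_n] returns to [Derive_n] on open sets. *)
Fixpoint Cn (n : nat) (U : R -> Prop) (f : R -> R) : Prop :=
  match n with
  | O => forall x, U x -> continuous f x
  | S k => exists f' : R -> R, (forall x, U x -> is_derive f x (f' x)) /\ Cn k U f'
  end.

Lemma Cn_continuous n U f : Cn n U f -> forall x, U x -> continuous f x.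
Proof.
destruct n as [|n]; [easy|]. intros (f' & H & _) x Hx.
apply (ex_derive_continuous f). eexists; apply H, Hx.
Qed.

Lemma Cn_pred n U f : Cn (S n) U f -> Cn n U f.
Proof.
revert f; induction n as [|n IH]; intros f H.
- exact (Cn_continuous 1 U f H).
- destruct H as (f' & H1 & H2). exists f'. split; [exact H1 | apply IH, H2].
Qed.

Lemma Cn_const n U (c : R) : Cn n U (fun _ => c).
Proof.
revert c; induction n as [|n IH]; intros c.
- intros x _. apply continuous_const.
- exists (fun _ => 0). split; [intros; apply @is_derive_const | apply IH].
Qed.

Lemma Cn_id n U : Cn n U (fun x => x).
Proof.
destruct n as [|n].
- intros x _. apply continuous_id.
- exists (fun _ => 1). split; [intros; apply @is_derive_id | apply Cn_const].
Qed.

Lemma Cn_plus n U f g : Cn n U f -> Cn n U g -> Cn n U (fun x => f x + g x).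
Proof.
revert f g; induction n as [|n IH]; intros f g Hf Hg.
- intros x Hx. apply (continuous_plus f g); auto.
- destruct Hf as (f' & H1 & H2), Hg as (g' & H3 & H4).
  exists (fun x => f' x + g' x). split; [|now apply IH].
  intros x Hx. apply (is_derive_plus f g); auto.
Qed.

Lemma Cn_mult n U f g : Cn n U f -> Cn n U g -> Cn n U (fun x => f x * g x).
Proof.
revert f g; induction n as [|n IH]; intros f g Hf Hg.
- intros x Hx. apply (continuous_mult f g); auto.
- pose proof (Cn_pred _ _ _ Hf) as Hf0. pose proof (Cn_pred _ _ _ Hg) as Hg0.
  destruct Hf as (f' & H1 & H2), Hg as (g' & H3 & H4).
  exists (fun x => f' x * g x + f x * g' x). split.
  + intros x Hx. apply (is_derive_mult f g); auto. intros; apply Rmult_comm.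
  + apply Cn_plus; apply IH; auto.
Qed.

Lemma Cn_inv n U f :
  (forall x, U x -> f x <> 0) -> Cn n U f -> Cn n U (fun x => / f x).
Proof.
intros Hne. induction n as [|n IH]; intros Hf.
- intros x Hx. apply continuous_Rinv_comp; auto.
- pose proof (IH (Cn_pred _ _ _ Hf)) as Hi.
  destruct Hf as (f' & H1 & H2).
  exists (fun x => -1 * (f' x * (/ f x * / f x))). split.
  + intros x Hx.
    replace (-1 * (f' x * (/ f x * / f x))) with (- f' x / f x ^ 2)
      by (field; auto).
    apply is_derive_inv; auto.
  + apply Cn_mult; [apply Cn_const|]. apply Cn_mult; [exact H2|]. now apply Cn_mult.
Qed.

(** Differentiation gives [2 * x] times a series of the same kind, again of infinite radius, so the
    induction closes. *)
Lemma Cn_PSeries_sqr n U a :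
  CV_radius a = p_infty -> Cn n U (fun x => PSeries a (x ^ 2)).
Proof.
assert (H : forall c x, CV_radius c = p_infty ->
  is_derive (fun y => PSeries c (y ^ 2)) x (2 * x * PSeries (PS_derive c) (x ^ 2))).
{ intros c x Hc. apply (is_derive_comp (PSeries c) (fun y => y ^ 2)).
  - apply is_derive_PSeries. now rewrite Hc.
  - auto_derive; [trivial | ring]. }
revert a; induction n as [|n IH]; intros a Ha.
- intros x _. apply (ex_derive_continuous (fun y => PSeries a (y ^ 2))). eexists; apply H, Ha.
- exists (fun x => 2 * x * PSeries (PS_derive a) (x ^ 2)).
  split; [intros; now apply H|].
  repeat apply Cn_mult; [apply Cn_const | apply Cn_id | apply IH].
  now rewrite CV_radius_derive.
Qed.

Lemma Cn_sin n U : Cn n U sin /\ Cn n U cos.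
Proof.
induction n as [|n [IHs IHc]].
- split; intros x _; [apply continuous_sin | apply continuous_cos].
- split.
  + exists cos. split; [intros; apply is_derive_sin | exact IHc].
  + exists (fun x => -1 * sin x). split.
    * intros x _. auto_derive; [trivial | ring].
    * apply Cn_mult; [apply Cn_const | exact IHs].
Qed.

Lemma ex_derive_n_Derive_n (f : R -> R) (k m : nat) (x : R) :
  ex_derive_n f (m + k) x -> ex_derive_n (Derive_n f k) m x.
Proof.
destruct m as [|m]; [easy|]. simpl. apply ex_derive_ext.
intros t. symmetry. apply Derive_n_comp.
Qed.

(** Openness makes [f] differentiable with derivative [f'] on a whole neighbourhood, which is what
    lets the higher derivatives of [f] be read off from those of [f']. *)
Lemma Cn_Derive_n n U f : open U -> Cn n U f ->
  forall k x, (k <= n)%nat -> U x ->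
  ex_derive_n f k x /\ continuous (Derive_n f k) x.
Proof.
intros HU. revert f; induction n as [|n IH]; intros f Hf k x Hk Hx.
- replace k with 0%nat by lia. split; [exact I|]. apply (Cn_continuous 0 U); auto.
- destruct k as [|k]; [split; [exact I | apply (Cn_continuous _ U _ Hf x Hx)]|].
  pose proof Hf as (f' & H1 & H2).
  assert (HD : forall j y, U y -> Derive_n f (S j) y = Derive_n f' j y).
  { intros j y Hy. rewrite <- Nat.add_1_r, <- Derive_n_comp.
    apply Derive_n_ext_loc. apply (filter_imp U); [|now apply HU].
    intros z Hz. now apply is_derive_unique, H1. }
  destruct (IH f' H2 k x ltac:(lia) Hx) as [E1 E2]. split.
  + destruct k as [|k]; [eexists; now apply H1|].
    simpl. eapply ex_derive_ext_loc; [|exact E1].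
    apply (filter_imp U); [|now apply HU]. intros z Hz. symmetry. now apply HD.
  + eapply continuous_ext_loc; [|exact E2].
    apply (filter_imp U); [|now apply HU]. intros z Hz. symmetry. now apply HD.
Qed.

Lemma continuous_bounded (f : R -> R) (a b : R) :
  (forall x, a <= x <= b -> continuous f x) ->
  exists M, 0 <= M /\ forall x, a <= x <= b -> Rabs (f x) <= M.
Proof.
intros H. destruct (bounded_continuity (K := R_AbsRing) (V := R_NormedModule) f a b H) as [M HM].
exists (Rabs M). split; [apply Rabs_pos|].
intros x Hx. eapply Rle_trans; [|apply Rle_abs]. apply Rlt_le, HM, Hx.
Qed.

(** * Boole summation *)

Definition delta0 (n : nat) : R := match n with O => 1 | S _ => 0 end.

(* The coefficients of [tanh (z / 2)], specified by
   [tanh (z / 2) * (1 + e^z) = e^z - 1]. *)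
Definition tanh_coef (t : nat -> R) : Prop :=
  forall n, t n + psum (fun k => t k * / INR (fact (n - k))) (S n)
            = / INR (fact n) - delta0 n.

(** With D the derivative, this is the operator tanh(h D / 2) truncated at order [K], applied to [f]
    at [x]. *)
Definition bdry (t : nat -> R) (K : nat) (f : R -> R) (h x : R) : R :=
  psum (fun k => t k * h ^ k * Derive_n f k x) K.

Definition smooth_on (K : nat) (f : R -> R) (a b : R) : Prop :=
  forall x, a <= x <= b -> forall k, (k <= K)%nat -> ex_derive_n f k x.

Lemma inv_fact_bound (n : nat) : 0 < / INR (fact n) <= 1.
Proof.
pose proof (lt_O_fact n) as H. apply le_INR in H. simpl in H.
split; [apply Rinv_0_lt_compat; lra|].
rewrite <- Rinv_1. apply Rinv_le_contravar; lra.
Qed.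

(** Lagrange's remainder. The expansion of the [k]-th derivative stops after [K - k] terms, so that
    all [k] reach the same total order [K]. *)
Lemma Taylor_bound (K k : nat) (f : R -> R) (x h M : R) :
  0 < h -> (k < K)%nat -> smooth_on K f x (x + h) ->
  (forall y, x <= y <= x + h -> Rabs (Derive_n f K y) <= M) ->
  Rabs (Derive_n f k (x + h)
    - psum (fun i => h ^ i * / INR (fact i) * Derive_n f (k + i) x) (K - k))
  <= h ^ (K - k) * M.
Proof.
intros Hh Hk Hs HM.
destruct (Taylor_Lagrange (Derive_n f k) (K - k - 1) x (x + h)) as (z & Hz & E); [lra| |].
{ intros y Hy j Hj. apply ex_derive_n_Derive_n, Hs; [exact Hy | lia]. }
rewrite E, psum_sum_f_R0, !Derive_n_comp.
replace (S (K - k - 1)) with (K - k)%nat by lia.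
replace (K - k + k)%nat with K by lia.
replace (x + h - x) with h by ring.
rewrite (psum_ext _ (fun i => h ^ i * / INR (fact i) * Derive_n f (k + i) x)).
2:{ intros i _. rewrite Derive_n_comp, (Nat.add_comm i k). reflexivity. }
replace (_ + _ - _) with (h ^ (K - k) * (/ INR (fact (K - k)) * Derive_n f K z))
  by (unfold Rdiv; ring).
rewrite Rabs_mult. pose proof (pow_lt h (K - k) Hh).
rewrite Rabs_pos_eq by lra. apply Rmult_le_compat_l; [lra|].
rewrite Rabs_mult. pose proof (inv_fact_bound (K - k)).
rewrite (Rabs_pos_eq (/ _)) by lra.
assert (Rabs (Derive_n f K z) <= M) by (apply HM; lra).
rewrite <- (Rmult_1_l M). apply Rmult_le_compat; try lra. apply Rabs_pos.
Qed.

(** The shift E = e^(h D) satisfies E - 1 = tanh(h D / 2) (1 + E). After Taylor expansion at [x],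
    all orders below [K] cancel by [tanh_coef] and only remainders are left. The constant is uniform
    in [f], [x] and [h]. *)
Lemma boole_step (t : nat -> R) (K : nat) : tanh_coef t -> (1 <= K)%nat ->
  exists C, 0 <= C /\ forall f x h M, 0 < h -> smooth_on K f x (x + h) ->
  (forall y, x <= y <= x + h -> Rabs (Derive_n f K y) <= M) ->
  Rabs (f (x + h) - f x - bdry t K f h x - bdry t K f h (x + h)) <= C * h ^ K * M.
Proof.
(* The [1] pays for the Taylor remainder of [f (x + h)], each [Rabs (t k)] for that of the [k]-th
   derivative at [x + h]. *)
intros Ht HK. exists (1 + psum (fun k => Rabs (t k)) K). split.
{ assert (0 <= psum (fun k => Rabs (t k)) K); [|lra].
  eapply Rle_trans; [apply Rabs_pos | apply (psum_abs_le t)]. intros; lra. }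
intros f x h M Hh Hs HM.
set (P k := psum (fun i => h ^ i * / INR (fact i) * Derive_n f (k + i) x) (K - k)).
assert (HR : forall k, (k < K)%nat ->
  Rabs (Derive_n f k (x + h) - P k) <= h ^ (K - k) * M)
  by (intros; now apply Taylor_bound).
assert (E : P 0%nat - f x - bdry t K f h x - psum (fun k => t k * h ^ k * P k) K = 0).
{ unfold P at 2.
  rewrite (psum_ext (fun k => t k * h ^ k * _)
    (fun k => psum (fun i => t k * / INR (fact i) * (h ^ (k + i) * Derive_n f (k + i) x)) (K - k))).
  2:{ intros k _. rewrite <- psum_scal. apply psum_ext. intros i _. rewrite pow_add. ring. }
  (* Grouping by the total order s = k + i collects the power [h ^ s]; its coefficient is the
     convolution in [tanh_coef]. *)
  rewrite psum_triangle.
  rewrite (psum_ext (fun s => psum _ (S s))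
    (fun s => psum (fun k => t k * / INR (fact (s - k))) (S s) * (h ^ s * Derive_n f s x))).
  2:{ intros s _. rewrite Rmult_comm, <- psum_scal. apply psum_ext. intros k Hk.
      replace (k + (s - k))%nat with s by lia. ring. }
  unfold P, bdry. rewrite Nat.sub_0_r.
  set (A := psum (fun i => h ^ i * / INR (fact i) * Derive_n f (0 + i) x) K).
  set (T1 := psum (fun k => t k * h ^ k * Derive_n f k x) K).
  set (T2 := psum (fun s => _ * (h ^ s * Derive_n f s x)) K).
  assert (E : 1 * T1 + 1 * T2 = 1 * A + -1 * f x); [|lra].
  unfold T1, T2, A. rewrite <- psum_lin.
  replace (-1 * f x)
    with (-1 * psum (fun s => delta0 s * f x) K).
  2:{ destruct K as [|K]; [lia|]. rewrite psum_head, (psum_ext _ (fun _ => 0 * 0)), psum_scal by (intros; unfold delta0; ring). unfold delta0; ring. }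
  rewrite <- psum_lin. apply psum_ext. intros s _. pose proof (Ht s) as Hts.
  replace (psum (fun k => t k * / INR (fact (s - k))) (S s))
    with (/ INR (fact s) - delta0 s - t s) by lra.
  simpl (0 + s)%nat. unfold delta0. destruct s; [cbn [Derive_n pow] | ]; ring. }
assert (EE : f (x + h) - f x - bdry t K f h x - bdry t K f h (x + h)
  = (Derive_n f 0 (x + h) - P 0%nat)
    + - psum (fun k => t k * h ^ k * (Derive_n f k (x + h) - P k)) K).
{ rewrite (psum_ext (fun k => t k * h ^ k * (Derive_n f k (x + h) - P k))
    (fun k => 1 * (t k * h ^ k * Derive_n f k (x + h)) + -1 * (t k * h ^ k * P k)))
    by (intros; ring).
  rewrite psum_lin. simpl (Derive_n f 0 _). unfold bdry at 2. lra. }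
rewrite EE. eapply Rle_trans; [apply Rabs_triang|]. rewrite Rabs_Ropp.
pose proof (HR 0%nat ltac:(lia)) as H0. rewrite Nat.sub_0_r in H0.
assert (H1 : Rabs (psum (fun k => t k * h ^ k * (Derive_n f k (x + h) - P k)) K)
  <= psum (fun k => h ^ K * M * Rabs (t k)) K).
{ apply psum_abs_le. intros k Hk. rewrite !Rabs_mult.
  pose proof (pow_lt h k Hh). rewrite (Rabs_pos_eq (h ^ k)) by lra.
  replace (h ^ K * M * Rabs (t k)) with (Rabs (t k) * h ^ k * (h ^ (K - k) * M)).
  - apply Rmult_le_compat_l; [|now apply HR].
    apply Rmult_le_pos; [apply Rabs_pos | lra].
  - replace (h ^ K) with (h ^ k * h ^ (K - k)); [ring|].
    rewrite <- pow_add. f_equal. lia. }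
rewrite psum_scal in H1. lra.
Qed.

(* The half-weighted alternating sum of [f], written as an alternating sum of
   its increments. *)
Lemma boole_sum (t : nat -> R) (K : nat) : tanh_coef t -> (1 <= K)%nat ->
  exists C, 0 <= C /\ forall f a h M m, 0 < h -> smooth_on K f a (a + INR m * h) ->
  (forall y, a <= y <= a + INR m * h -> Rabs (Derive_n f K y) <= M) ->
  Rabs (psum (fun l => (-1) ^ l * (f (a + INR (S l) * h) - f (a + INR l * h))) m
        - (bdry t K f h a - (-1) ^ m * bdry t K f h (a + INR m * h)))
  <= INR m * (C * h ^ K * M).
Proof.
intros Ht HK. destruct (boole_step t K Ht HK) as (C & HC & H).
exists C. split; [exact HC|]. intros f a h M m Hh. induction m as [|m IH]; intros Hs HM.
- simpl INR. rewrite !Rmult_0_l, Rplus_0_r. simpl.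
  replace (_ - _) with 0 by ring. rewrite Rabs_R0. lra.
- rewrite S_INR in Hs, HM. pose proof (pos_INR m) as Hm.
  pose proof (Rmult_le_pos _ _ Hm (Rlt_le _ _ Hh)) as Hmh.
  assert (IH' := IH ltac:(intros y Hy; apply Hs; lra) ltac:(intros y Hy; apply HM; lra)).
  assert (S1 := H f (a + INR m * h) h M Hh
    ltac:(intros y Hy; apply Hs; lra) ltac:(intros y Hy; apply HM; lra)).
  replace (a + INR m * h + h) with (a + INR (S m) * h) in S1 by (rewrite S_INR; ring).
  cbn [psum]. rewrite <- tech_pow_Rmult. 
  replace (INR (S m) * (C * h ^ K * M)) with ((INR m + 1) * (C * h ^ K * M))
    by (rewrite S_INR; ring).
  set (X := psum _ m) in *. set (b0 := bdry t K f h a) in *.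
  set (b1 := bdry t K f h (a + INR m * h)) in *.
  set (b2 := bdry t K f h (a + INR (S m) * h)) in *.
  set (D := f (a + INR (S m) * h) - f (a + INR m * h)) in *.
  (* The boundary term [b1] at the shared node occurs with opposite signs in the two brackets and
     telescopes. *)
  replace (X + (-1) ^ m * D - (b0 - -1 * (-1) ^ m * b2))
    with ((X - (b0 - (-1) ^ m * b1)) + (-1) ^ m * (D - b1 - b2)) by ring.
  eapply Rle_trans; [apply Rabs_triang|].
  rewrite Rabs_mult, pow_1_abs. lra.
Qed.

(** * Power series *)

(** An explicit witness that the radius of convergence is at least [r]. It passes through linear
    combinations, shifts and rescalings by termwise estimates. *)
Definition geo (a : nat -> R) (r : R) : Prop :=
  exists M, forall n, Rabs (a n) * r ^ n <= M.

Lemma geo_radius a r x : geo a r -> Rabs x < r -> Rbar_lt (Rabs x) (CV_radius a).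
Proof.
intros [M HM] Hx. apply Rbar_lt_le_trans with r; [exact Hx|].
apply (proj1 (CV_radius_bounded a)). exists M. intros n.
pose proof (Rabs_pos x). rewrite Rabs_mult, (Rabs_pos_eq (r ^ n)); [apply HM|].
apply pow_le; lra.
Qed.

Lemma geo_ex_pseries a r x : geo a r -> Rabs x < r -> ex_pseries a x.
Proof. intros H Hx. apply CV_radius_inside. now apply geo_radius with r. Qed.

Lemma geo_radius_pos a r : 0 < r -> geo a r -> Rbar_lt 0 (CV_radius a).
Proof. intros Hr H. rewrite <- Rabs_R0. apply geo_radius with r; rewrite ?Rabs_R0; auto. Qed.

Lemma ex_pseries_geo a r : 0 < r -> ex_pseries a r -> geo a r.
Proof.
intros Hr H.
assert (L : is_lim_seq (fun n => a n * r ^ n) 0).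
{ apply ex_series_lim_0. revert H. unfold ex_pseries. apply ex_series_ext.
  intros n. rewrite <- pow_n_pow. apply Rmult_comm. }
destruct (filterlim_bounded (K := R_AbsRing) (V := R_NormedModule) (fun n => a n * r ^ n)) as [M HM].
{ exists 0. exact L. }
exists M. intros n. specialize (HM n). unfold norm in HM; simpl in HM.
unfold abs in HM; simpl in HM.
rewrite Rabs_mult, (Rabs_pos_eq (r ^ n)) in HM; [exact HM|]. apply pow_le; lra.
Qed.

Lemma geo_le a r r' : 0 <= r' <= r -> geo a r -> geo a r'.
Proof.
intros Hr [M HM]. exists M. intros n. eapply Rle_trans; [|apply (HM n)].
apply Rmult_le_compat_l; [apply Rabs_pos | now apply pow_incr].
Qed.

Lemma geo_bounded a M r : 0 <= r <= 1 -> (forall n, Rabs (a n) <= M) -> geo a r.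
Proof.
intros Hr H. exists M. intros n. rewrite <- (Rmult_1_r M).
apply Rmult_le_compat; [apply Rabs_pos | apply pow_le; lra | apply H |].
rewrite <- (pow1 n). now apply pow_incr.
Qed.

Lemma geo_dom a c r : 0 <= r -> (forall n, Rabs (a n) <= Rabs (c n)) -> geo c r -> geo a r.
Proof.
intros Hr H [M HM]. exists M. intros n. eapply Rle_trans; [|apply (HM n)].
apply Rmult_le_compat_r; [now apply pow_le | apply H].
Qed.

Lemma geo_lin x y a c r : 0 <= r ->
  geo a r -> geo c r -> geo (fun n => x * a n + y * c n) r.
Proof.
intros Hr [M HM] [M' HM']. exists (Rabs x * M + Rabs y * M'). intros n.
pose proof (pow_le r n Hr).
apply Rle_trans with (Rabs x * (Rabs (a n) * r ^ n) + Rabs y * (Rabs (c n) * r ^ n)).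
- rewrite <- !Rmult_assoc, <- Rmult_plus_distr_r, <- !Rabs_mult.
  apply Rmult_le_compat_r; [assumption | apply Rabs_triang].
- apply Rplus_le_compat; apply Rmult_le_compat_l; auto; apply Rabs_pos.
Qed.

(** The bound 2 covers the two substitutions needed, z -> 2 z and z -> - z. *)
Lemma geo_scale s a r : 0 <= r -> Rabs s <= 2 -> geo a r -> geo (fun n => s ^ n * a n) (r / 2).
Proof.
intros Hr Hs [M HM]. exists M. intros n. eapply Rle_trans; [|apply (HM n)].
rewrite Rabs_mult, <- RPow_abs.
replace (Rabs s ^ n * Rabs (a n) * (r / 2) ^ n) with (Rabs (a n) * (Rabs s * (r / 2)) ^ n)
  by (rewrite Rpow_mult_distr; ring).
apply Rmult_le_compat_l; [apply Rabs_pos|].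
pose proof (Rabs_pos s). apply pow_incr. split; [|nra].
apply Rmult_le_pos; lra.
Qed.

Lemma geo_decr a r : 0 < r -> geo a r -> geo (PS_decr_1 a) r.
Proof.
intros Hr [M HM]. exists (M / r). intros n. unfold PS_decr_1.
specialize (HM (S n)). simpl in HM.
apply Rmult_le_reg_r with r; [lra|]. replace (M / r * r) with M by (field; lra). lra.
Qed.

Lemma geo_even a r : 0 <= r -> geo a r -> geo (fun n => a (2 * n)%nat) (r ^ 2).
Proof. intros Hr [M HM]. exists M. intros n. rewrite <- pow_mult. apply HM. Qed.

Lemma PSeries_lin x y a c r z : geo a r -> geo c r -> Rabs z < r ->
  PSeries (fun n => x * a n + y * c n) z = x * PSeries a z + y * PSeries c z.
Proof.
intros Ha Hc Hz.
apply is_pseries_unique.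
pose proof (PSeries_correct _ _ (geo_ex_pseries _ _ _ Ha Hz)) as H1.
pose proof (PSeries_correct _ _ (geo_ex_pseries _ _ _ Hc Hz)) as H2.
apply (is_pseries_plus (PS_scal x a) (PS_scal y c) z (x * PSeries a z) (y * PSeries c z));
  apply (is_pseries_scal (K := R_AbsRing) (V := R_NormedModule)); try assumption; apply Rmult_comm.
Qed.

Lemma PSeries_scale s a x : PSeries (fun n => s ^ n * a n) x = PSeries a (s * x).
Proof. apply Series_ext. intros n. rewrite Rpow_mult_distr. ring. Qed.

Lemma geo_delta0 r : 0 <= r <= 1 -> geo delta0 r.
Proof.
intros Hr. apply geo_bounded with 1; [exact Hr|].
intros [|n]; simpl; rewrite ?Rabs_R1, ?Rabs_R0; lra.
Qed.

Lemma PSeries_delta0 x : PSeries delta0 x = 1.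
Proof.
unfold PSeries. apply is_series_unique.
assert (E : forall n, sum_n (fun k => delta0 k * x ^ k) n = 1).
{ induction n as [|n IH]; [rewrite sum_O; simpl; ring|].
  rewrite sum_Sn, IH. unfold plus; simpl; ring. }
unfold is_series. eapply filterlim_ext; [intros n; symmetry; apply E | apply filterlim_const].
Qed.

Lemma geo_inv_fact r : 0 <= r <= 1 -> geo (fun n => / INR (fact n)) r.
Proof.
intros Hr. apply geo_bounded with 1; [exact Hr|]. intros n.
pose proof (inv_fact_bound n). rewrite Rabs_pos_eq; lra.
Qed.

Lemma PS_mult_psum a c n : PS_mult a c n = psum (fun k => a k * c (n - k)%nat) (S n).
Proof. apply psum_sum_f_R0. Qed.

(** The product converges at the interior point [r / 2], so its terms are bounded there. The lost
    factor is harmless, since any positive radius suffices to compare coefficients. *)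
Lemma geo_PS_mult a c r : 0 < r -> geo a r -> geo c r -> geo (PS_mult a c) (r / 2).
Proof.
intros Hr Ha Hc. assert (Rabs (r / 2) < r) by (rewrite Rabs_pos_eq; lra).
apply ex_pseries_geo; [lra|]. apply ex_pseries_mult; now apply geo_radius with r.
Qed.

Lemma PSeries_coef_unique a c r : 0 < r -> geo a r -> geo c r ->
  (forall x, Rabs x < r -> PSeries a x = PSeries c x) -> forall n, a n = c n.
Proof.
intros Hr Ha Hc H n. apply PSeries_ext_recip; try (now apply geo_radius_pos with r).
exists (mkposreal r Hr). intros x Hx. apply H. revert Hx.
unfold ball; simpl; unfold AbsRing_ball, abs, minus, plus, opp; simpl.
now rewrite Ropp_0, Rplus_0_r.
Qed.

Lemma PSeries_mult_coef a c d r : 0 < r -> geo a r -> geo c r -> geo d r ->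
  (forall x, Rabs x < r -> PSeries a x * PSeries c x = PSeries d x) ->
  forall n, psum (fun k => a k * c (n - k)%nat) (S n) = d n.
Proof.
intros Hr Ha Hc Hd H n. rewrite <- PS_mult_psum.
apply PSeries_coef_unique with (r / 2); [lra | now apply geo_PS_mult | |].
- apply geo_le with r; [lra | assumption].
- intros x Hx. rewrite PSeries_mult; [apply H; lra | |]; apply geo_radius with r; auto; lra.
Qed.

(** * Bernoulli numbers *)

(** Clearing the denominator makes the identity hold at [z = 0] as well. The bound [r <= 1] makes
    every bounded coefficient sequence satisfy [geo] at [r]. *)
Definition bernoulli_egf (b : nat -> R) (r : R) : Prop :=
  0 < r <= 1 /\ geo b r /\ forall z, Rabs z < r -> PSeries b z * (exp z - 1) = z.

Lemma bernoulli_egf_exists (B : nat -> R) : bernoulli_numbers B ->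
  exists r, bernoulli_egf (fun n => B n / INR (fact n)) r.
Proof.
intros [d Hd].
assert (Hb : forall z, Rabs z < d -> z <> 0 ->
  is_pseries (fun n => B n / INR (fact n)) z (z / (exp z - 1))).
{ intros z Hz Hz0. apply Hd; [|exact Hz0].
  unfold ball; simpl; unfold AbsRing_ball, abs, minus, plus, opp; simpl.
  now rewrite Ropp_0, Rplus_0_r. }
pose proof (cond_pos d) as Hd0.
(* Half of [d], so that the series converges at [r] itself and its terms are bounded there. *)
set (r := Rmin (d / 2) 1).
assert (Hr : 0 < r <= 1 /\ r < d).
{ unfold r. pose proof (Rmin_l (d / 2) 1). pose proof (Rmin_r (d / 2) 1).
  repeat split; try lra. apply Rmin_pos; lra. }
exists r. split; [easy|]. split.
- apply ex_pseries_geo; [easy|]. eexists. apply Hb; [rewrite Rabs_pos_eq|]; lra.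
- intros z Hz. destruct (Req_dec z 0) as [->|Hz0]; [rewrite exp_0; ring|].
  rewrite (is_pseries_unique _ _ _ (Hb z ltac:(lra) Hz0)). field.
  intros H. apply Hz0, exp_inv. rewrite exp_0. lra.
Qed.

Lemma exp_neq_1 z : z <> 0 -> exp z - 1 <> 0.
Proof. intros Hz H. apply Hz, exp_inv. rewrite exp_0. lra. Qed.

Lemma exp_double z : exp (2 * z) = exp z * exp z.
Proof. rewrite <- exp_plus. f_equal. ring. Qed.

(** Coefficients of b(z) (e^z - 1) = z; the term [k = n] is missing because e^z - 1 has no constant
    term. The right side is 1 for [n = 1] and 0 otherwise: the second factor corrects the truncated
    [n - 1] at [n = 0]. *)
Lemma bernoulli_conv b r (HB : bernoulli_egf b r) (n : nat) :
  psum (fun k => b k * / INR (fact (n - k))) n = delta0 (n - 1) * (1 - delta0 n).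
Proof.
pose proof HB as (HR0 & Hgeo & Hgen).
pose proof (PSeries_mult_coef b (fun n => 1 * / INR (fact n) + -1 * delta0 n)
  (PS_incr_1 delta0) r (proj1 HR0) Hgeo) as H.
assert (H' := H
  ltac:(apply geo_lin; [lra | apply geo_inv_fact; lra | apply geo_delta0; lra])).
clear H. rename H' into H.
assert (Hg : geo (PS_incr_1 delta0) r).
{ apply geo_bounded with 1; [lra|]. intros [|[|k]]; simpl; rewrite ?Rabs_R1; try lra;
  unfold zero; simpl; rewrite Rabs_R0; lra. }
specialize (H Hg). cbn [psum] in H.
assert (Hz : forall x, Rabs x < r ->
  PSeries b x * PSeries (fun n => 1 * / INR (fact n) + -1 * delta0 n) x
  = PSeries (PS_incr_1 delta0) x).
{ intros x Hx. rewrite (PSeries_lin _ _ _ _ r), <- exp_Reals, PSeries_delta0,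
    PSeries_incr_1, PSeries_delta0; [| apply geo_inv_fact; lra | apply geo_delta0; lra | exact Hx].
  pose proof (Hgen x Hx). lra. }
specialize (H Hz n). rewrite Nat.sub_diag in H. simpl (fact 0) in H. simpl (INR 1) in H.
rewrite Rinv_1 in H. cbn [delta0] in H.
rewrite (psum_ext _ (fun k => b k * (1 * / INR (fact (n - k)) + -1 * delta0 (n - k)))).
2:{ intros k Hk. destruct (n - k)%nat as [|j] eqn:E; [lia|]. simpl (delta0 (S j)). ring. }
replace (delta0 (n - 1) * (1 - delta0 n)) with (PS_incr_1 delta0 n); [lra|].
destruct n as [|k]; simpl; [unfold zero; simpl; ring|]. rewrite Nat.sub_0_r. ring.
Qed.

Lemma bernoulli_0 b r (HB : bernoulli_egf b r) : b 0%nat = 1.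
Proof. pose proof (bernoulli_conv b r HB 1) as H. simpl in H. lra. Qed.

Lemma bernoulli_1 b r (HB : bernoulli_egf b r) : b 1%nat = - / 2.
Proof.
pose proof (bernoulli_conv b r HB 2) as H. pose proof (bernoulli_0 b r HB) as H0. simpl in H.
assert (b 0%nat * / (1 + 1) = / 2) by (rewrite H0; lra). lra.
Qed.

(** From b(- z) = b(z) + z: comparing coefficients gives - b_n = b_n for odd n other than 1. *)
Lemma bernoulli_odd b r (HB : bernoulli_egf b r) (k : nat) : (1 <= k)%nat -> b (2 * k + 1)%nat = 0.
Proof.
pose proof HB as (HR0 & Hgeo & Hgen).
intros Hk.
assert (H : forall n, (-1) ^ n * b n = 1 * b n + 1 * PS_incr_1 delta0 n).
{ assert (Hg1 : geo b (r / 2)) by (apply geo_le with r; [lra | exact Hgeo]).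
  assert (Hg : geo (PS_incr_1 delta0) (r / 2)).
  { apply geo_bounded with 1; [lra|]. intros [|[|j]]; simpl; rewrite ?Rabs_R1; try lra;
    unfold zero; simpl; rewrite Rabs_R0; lra. }
  apply (PSeries_coef_unique _ _ (r / 2)); [lra | | |].
  - apply geo_scale; [lra | rewrite Rabs_left; lra | exact Hgeo].
  - apply geo_lin; auto; lra.
  - intros x Hx. rewrite PSeries_scale, (PSeries_lin _ _ _ _ (r / 2)), PSeries_incr_1, PSeries_delta0 by auto.
    destruct (Req_dec x 0) as [->|Hx0].
    + rewrite Rmult_0_r. ring.
    + apply Rmult_eq_reg_r with (exp x - 1); [|now apply exp_neq_1].
      pose proof (Hgen x ltac:(lra)).
      replace (-1 * x) with (- x) by ring.
      pose proof (Hgen (- x) ltac:(rewrite Rabs_Ropp; lra)) as H1.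
      rewrite exp_Ropp in H1. pose proof (exp_pos x).
      replace (PSeries b (- x) * (exp x - 1))
        with (- exp x * (PSeries b (- x) * (/ exp x - 1))) by (field; lra).
      rewrite H1. lra. }
specialize (H (2 * k + 1)%nat). rewrite pow_add, pow_1_even in H.
destruct k as [|k]; [lia|]. replace (2 * S k + 1)%nat with (S (S (2 * k + 1))) in * by lia.
cbn [PS_incr_1 delta0] in H. simpl pow in H. lra.
Qed.

(** Since 1 / (e^z + 1) = 1 / (e^z - 1) - 2 / (e^(2z) - 1), one has tanh(z / 2) = 1 + (2 b(2z) - 2
    b(z)) / z with b(z) = z / (e^z - 1). *)
Definition tanh_ps (b : nat -> R) (k : nat) : R := 2 * (2 ^ S k - 1) * b (S k) + delta0 k.

Lemma tanh_ps_even b r (HB : bernoulli_egf b r) (k : nat) : tanh_ps b (2 * k) = 0.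
Proof.
unfold tanh_ps. destruct k as [|k].
- simpl. rewrite (bernoulli_1 b r HB). lra.
- replace (S (2 * S k)) with (2 * S k + 1)%nat by lia.
  rewrite (bernoulli_odd b r HB) by lia.
  replace (2 * S k)%nat with (S (2 * k + 1)) by lia. simpl. ring.
Qed.

Lemma tanh_ps_correct b r (HB : bernoulli_egf b r) : tanh_coef (tanh_ps b).
Proof.
pose proof HB as (HR0 & Hgeo & Hgen).
set (c := fun n => 2 * (2 ^ n * b n) + -2 * b n).
assert (Hg1 : geo b (r / 2)) by (apply geo_le with r; [lra | exact Hgeo]).
assert (Hg2 : geo (fun n => 2 ^ n * b n) (r / 2))
  by (apply geo_scale; [lra | rewrite Rabs_pos_eq; lra | exact Hgeo]).
assert (Hc : geo c (r / 2)) by (apply geo_lin; auto; lra).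
assert (Hd : geo (PS_decr_1 c) (r / 2)) by (apply geo_decr; auto; lra).
assert (H0 : geo delta0 (r / 2)) by (apply geo_delta0; lra).
assert (He : geo (fun n => / INR (fact n)) (r / 2)) by (apply geo_inv_fact; lra).
set (t := fun n => 1 * PS_decr_1 c n + 1 * delta0 n).
assert (Et : forall n, tanh_ps b n = t n) by (intros n; unfold tanh_ps, t, c, PS_decr_1; ring).
intros n.
assert (H : psum (fun k => t k * (1 * / INR (fact (n - k)) + 1 * delta0 (n - k))) (S n)
  = 1 * / INR (fact n) + -1 * delta0 n).
{ apply (PSeries_mult_coef t (fun j => 1 * / INR (fact j) + 1 * delta0 j)
    (fun j => 1 * / INR (fact j) + -1 * delta0 j) (r / 2));
    [lra | apply geo_lin; auto; lra | apply geo_lin; auto; lra | apply geo_lin; auto; lra |].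
  intros x Hx.
  unfold t. rewrite !(PSeries_lin _ _ _ _ (r / 2)) by auto.
  rewrite <- exp_Reals, PSeries_delta0.
  destruct (Req_dec x 0) as [->|Hx0].
  - rewrite PSeries_0, exp_0. unfold PS_decr_1, c. simpl. rewrite (bernoulli_1 b r HB). lra.
  - pose proof (PSeries_decr_1 c x (geo_ex_pseries _ _ _ Hc Hx)) as Ec.
    unfold c in Ec at 1. rewrite (PSeries_lin _ _ _ _ (r / 2)), PSeries_scale in Ec by auto.
    pose proof (Hgen x ltac:(lra)) as G1.
    pose proof (Hgen (2 * x) ltac:(rewrite Rabs_mult, (Rabs_pos_eq 2); lra)) as G2.
    (* Because [c 0 = 0], the shift [PS_decr_1 c] is division by [x]; the identity is then checked
       after multiplication by [x * (y - 1)], nonzero for [x <> 0]. *)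
    rewrite exp_double in G2.
    assert (E0 : c 0%nat = 0) by (unfold c; simpl; ring). rewrite E0 in Ec.
    pose proof (exp_neq_1 x Hx0) as Hn.
    set (y := exp x) in *. set (u := PSeries b x) in *. set (v := PSeries b (2 * x)) in *.
    set (w := PSeries (PS_decr_1 c) x) in *.
    apply Rmult_eq_reg_r with (x * (y - 1)).
    2:{ now apply Rmult_integral_contrapositive_currified. }
    transitivity ((x * w + x) * (y * y - 1)); [ring|].
    replace (x * w) with (2 * v + -2 * u) by lra.
    transitivity (2 * (v * (y * y - 1)) - 2 * (u * (y - 1)) * (y + 1) + x * (y * y - 1)); [ring|].
    rewrite G1, G2. ring. }
rewrite (psum_ext (fun k => tanh_ps b k * _) (fun k => t k * / INR (fact (n - k))))
  by (intros; now rewrite Et).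
rewrite Et. cbn [psum] in *. rewrite Nat.sub_diag in *.
rewrite (psum_ext _ (fun k => t k * / INR (fact (n - k)))) in H.
2:{ intros k Hk. destruct (n - k)%nat as [|j] eqn:E; [lia|]. simpl (delta0 (S j)). ring. }
cbn [delta0] in *. lra.
Qed.

Lemma bernoulli_values b r (HB : bernoulli_egf b r) :
  b 2%nat = / 12 /\ b 4%nat = - / 720 /\ b 6%nat = / 30240 /\ b 8%nat = - / 1209600.
Proof.
set (e := fun k => / INR (fact k)).
assert (C : forall n, psum (fun k => b k * e (n - k)%nat) n = delta0 (n - 1) * (1 - delta0 n))
  by exact (bernoulli_conv b r HB).
assert (e1 : e 1%nat = 1) by (unfold e; simpl; field).
assert (es : forall k, e (S k) = e k / INR (S k)).
{ intros k. unfold e. rewrite fact_simpl, mult_INR. field.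
  split; [apply INR_fact_neq_0 | now apply not_0_INR]. }
(* The inverse factorials become opaque and are computed by the recursion [es], so that no large
   unary factorial is unfolded. *)
clearbody e.
pose proof (bernoulli_0 b r HB) as b0. pose proof (bernoulli_1 b r HB) as b1.
pose proof (bernoulli_odd b r HB 1 ltac:(lia)) as b3. pose proof (bernoulli_odd b r HB 2 ltac:(lia)) as b5.
pose proof (bernoulli_odd b r HB 3 ltac:(lia)) as b7.
pose proof (es 1%nat) as e2. pose proof (es 2%nat) as e3. pose proof (es 3%nat) as e4.
pose proof (es 4%nat) as e5. pose proof (es 5%nat) as e6. pose proof (es 6%nat) as e7.
pose proof (es 7%nat) as e8. pose proof (es 8%nat) as e9.
rewrite e1 in e2. rewrite e2 in e3. rewrite e3 in e4. rewrite e4 in e5. rewrite e5 in e6.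
rewrite e6 in e7. rewrite e7 in e8. rewrite e8 in e9. simpl INR in *.
pose proof (C 3%nat) as C3. pose proof (C 5%nat) as C5. pose proof (C 7%nat) as C7.
pose proof (C 9%nat) as C9. clear C es.
simpl in *. rewrite ?e1, ?e2, ?e3, ?e4, ?e5, ?e6, ?e7, ?e8, ?e9, ?b0, ?b1, ?b3, ?b5, ?b7 in *.
clear - C3 C5 C7 C9.
assert (A2 : b 2%nat = / 12) by lra. rewrite A2 in *.
assert (A4 : b 4%nat = - / 720) by lra. rewrite A4 in *.
assert (A6 : b 6%nat = / 30240) by lra. rewrite A6 in *.
repeat split; lra.
Qed.

(** * The regular part of the cosecant *)

(* [sin x = x * PSeries sin_n (x ^ 2)], so this is [csc x - / x], with the
   singularity at [0] removed. *)
Definition csc_reg (x : R) : R :=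
  -1 * x * PSeries (PS_decr_1 sin_n) (x ^ 2) * / PSeries sin_n (x ^ 2).

Lemma CV_radius_sin_n : CV_radius sin_n = p_infty.
Proof.
apply CV_radius_infinite_DAlembert.
- intros n. unfold sin_n. apply Rmult_integral_contrapositive_currified.
  + apply pow_nonzero. lra.
  + apply Rinv_neq_0_compat, INR_fact_neq_0.
- apply is_lim_seq_Reals, Alembert_sin.
Qed.

Lemma sin_PSeries x : sin x = x * PSeries sin_n (x ^ 2).
Proof.
unfold sin. destruct (exist_sin (Rsqr x)) as [l Hl]. f_equal.
symmetry. apply is_pseries_unique, is_pseries_Reals.
replace (x ^ 2) with (Rsqr x) by (unfold Rsqr; ring). exact Hl.
Qed.

Lemma sinc_neq_0 x : - PI < x < PI -> PSeries sin_n (x ^ 2) <> 0.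
Proof.
intros Hx H. destruct (Req_dec x 0) as [->|Hx0].
- replace (0 ^ 2) with 0 in H by ring. rewrite PSeries_0 in H.
  unfold sin_n in H. simpl in H. lra.
- assert (Hs : sin x = 0) by (rewrite sin_PSeries, H; ring).
  destruct (Rlt_le_dec 0 x).
  + pose proof (sin_gt_0 x ltac:(lra) ltac:(lra)). lra.
  + pose proof (sin_gt_0 (- x) ltac:(lra) ltac:(lra)) as H1. rewrite sin_neg in H1. lra.
Qed.

Lemma sinc_decr w : PSeries sin_n w = 1 + w * PSeries (PS_decr_1 sin_n) w.
Proof.
rewrite PSeries_decr_1; [|apply CV_radius_inside; now rewrite CV_radius_sin_n].
f_equal. unfold sin_n. simpl. field.
Qed.

Lemma csc_split x : - PI < x < PI -> x <> 0 -> csc x = / x + csc_reg x.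
Proof.
intros Hx Hx0. unfold csc, csc_reg. rewrite sin_PSeries.
pose proof (sinc_neq_0 x Hx) as Hs.
assert (E : x ^ 2 * PSeries (PS_decr_1 sin_n) (x ^ 2) = PSeries sin_n (x ^ 2) - 1)
  by (rewrite (sinc_decr (x ^ 2)); ring).
set (s := PSeries sin_n (x ^ 2)) in *. set (d := PSeries (PS_decr_1 sin_n) (x ^ 2)) in *.
apply Rmult_eq_reg_r with (x * s * x).
2:{ now repeat apply Rmult_integral_contrapositive_currified. }
transitivity x; [field; auto|].
transitivity (x * s - x * (x ^ 2 * d)); [rewrite E; ring | field; auto].
Qed.

Lemma csc_reg_0 : csc_reg 0 = 0.
Proof. unfold csc_reg. ring. Qed.

Definition near_zero (x : R) : Prop := - PI < x < PI.

Lemma open_near_zero : open near_zero.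
Proof. apply open_and; [apply open_gt | apply open_lt]. Qed.

Lemma csc_reg_Cn n : Cn n near_zero csc_reg.
Proof.
unfold csc_reg.
apply Cn_mult; [apply Cn_mult; [apply Cn_mult; [apply Cn_const | apply Cn_id]|]|].
- apply Cn_PSeries_sqr.
  rewrite CV_radius_decr_1. apply CV_radius_sin_n.
- apply Cn_inv; [apply sinc_neq_0 | apply Cn_PSeries_sqr, CV_radius_sin_n].
Qed.

(* Taylor coefficients at [0] of [z / sinh z], in terms of [b n = B n / n!];
   they come from [z / sinh z = 2 z / (e^z - 1) - 2 z / (e^(2z) - 1)]. *)
Definition csch_ps (b : nat -> R) (n : nat) : R := 2 * b n + -1 * (2 ^ n * b n).

Lemma csch_ps_odd b r (HB : bernoulli_egf b r) k : csch_ps b (2 * k + 1) = 0.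
Proof.
unfold csch_ps. destruct k as [|k]; [simpl; ring|].
rewrite (bernoulli_odd b r HB) by lia. ring.
Qed.

Lemma PSeries_even_part a x r : geo a r -> Rabs x < r ->
  (forall n, a (2 * n + 1)%nat = 0) ->
  PSeries a x = PSeries (fun n => a (2 * n)%nat) (x ^ 2).
Proof.
intros Ha Hx Hodd. pose proof (Rabs_pos x) as Hp.
assert (Hx2 : Rabs (x ^ 2) < r ^ 2).
{ rewrite <- RPow_abs. simpl. nra. }
rewrite PSeries_odd_even.
- rewrite (PSeries_ext (fun n => a (2 * n + 1)%nat) (fun _ => 0) (x ^ 2) Hodd).
  rewrite PSeries_const_0. ring.
- apply (geo_ex_pseries _ (r ^ 2)); [apply geo_even; [lra | exact Ha] | exact Hx2].
- apply (ex_pseries_ext (fun _ => 0)); [intros; now rewrite Hodd|].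
  apply CV_radius_inside. now rewrite CV_radius_const_0.
Qed.

(** The two series are compared only at nonnegative arguments, while uniqueness needs a full
    neighbourhood of [0]. Inserting zeros at odd indices turns them into series in [x], equal for
    both signs of [x]. *)
Lemma PS_sqr_coef (P Q : nat -> R) r : 0 < r -> geo P (r ^ 2) -> geo Q (r ^ 2) ->
  (forall x, Rabs x < r -> PSeries P (x ^ 2) = PSeries Q (x ^ 2)) -> forall n, P n = Q n.
Proof.
intros Hr [M HM] [M' HM'] H n.
set (spread := fun (p : nat -> R) k => if Nat.even k then p (Nat.div2 k) else 0).
assert (Se : forall p k, spread p (2 * k)%nat = p k).
{ intros p k. unfold spread. rewrite Nat.even_even. now rewrite Nat.div2_double. }
assert (So : forall p k, spread p (2 * k + 1)%nat = 0).
{ intros p k. unfold spread. now rewrite Nat.even_odd. }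
assert (G : forall p K, (forall n, Rabs (p n) * (r ^ 2) ^ n <= K) -> geo (spread p) r).
{ intros p K HK. exists (Rmax K 0). intros k.
  destruct (Nat.Even_or_Odd k) as [[j ->]|[j ->]].
  - rewrite Se, pow_mult. eapply Rle_trans; [apply HK | apply Rmax_l].
  - rewrite So, Rabs_R0, Rmult_0_l. apply Rmax_r. }
rewrite <- (Se P), <- (Se Q).
apply (PSeries_coef_unique _ _ r); [exact Hr | now apply (G P M) | now apply (G Q M') |].
intros x Hx. rewrite (PSeries_even_part (spread P) x r), (PSeries_even_part (spread Q) x r);
  eauto.
rewrite (PSeries_ext _ P) by (intros; apply Se).
rewrite (PSeries_ext (fun n0 => spread Q (2 * n0)%nat) Q) by (intros; apply Se). now apply H.
Qed.

(* [z / sinh z] and [sinh z / z] are power series in [w = z ^ 2] that are inverse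
   to each other for [w >= 0], hence coefficientwise; at [w = - x ^ 2] they become
   [x / sin x] and [sin x / x]. *)
Lemma csch_sinc b r (HB : bernoulli_egf b r) x : Rabs x < r / 4 ->
  PSeries (fun n => csch_ps b (2 * n)) (- x ^ 2) * PSeries sin_n (x ^ 2) = 1.
Proof.
pose proof HB as (Hr & Hgeo & Hgen). intros Hx.
assert (Hg1 : geo b (r / 2)) by (apply geo_le with r; [lra | exact Hgeo]).
assert (Hg2 : geo (fun n => 2 ^ n * b n) (r / 2))
  by (apply geo_scale; [lra | rewrite Rabs_pos_eq; lra | exact Hgeo]).
assert (Hg : geo (csch_ps b) (r / 2)) by (apply geo_lin; auto; lra).
set (G := fun n => csch_ps b (2 * n)).
set (H := fun n => / INR (fact (2 * n + 1))).
set (rho := r / 2).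
assert (Hrho : 0 < rho <= / 2) by (unfold rho; lra).
assert (HG : geo G (rho ^ 2)) by (apply geo_even; [lra | exact Hg]).
assert (HH : geo H (rho ^ 2)).
{ apply geo_bounded with 1; [simpl; nra|]. intros n. unfold H.
  pose proof (inv_fact_bound (2 * n + 1)). rewrite Rabs_pos_eq; lra. }
assert (HC : geo (fun n => / INR (fact (2 * n))) (rho ^ 2)).
{ apply geo_bounded with 1; [simpl; nra|]. intros n.
  pose proof (inv_fact_bound (2 * n)). rewrite Rabs_pos_eq; lra. }
assert (Hsq : forall z, Rabs z < rho -> Rabs (z ^ 2) < rho ^ 2).
{ intros z Hz. pose proof (Rabs_pos z). rewrite <- RPow_abs. simpl. nra. }
(* The even part of exp is cosh z, the odd part is sinh z = z * H(z^2). *)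
assert (Hexp : forall z, Rabs z < rho -> exp z
  = PSeries (fun n => / INR (fact (2 * n))) (z ^ 2) + z * PSeries H (z ^ 2)).
{ intros z Hz. rewrite exp_Reals. apply PSeries_odd_even;
  eapply geo_ex_pseries; eauto. }
assert (HGH : forall z, Rabs z < rho -> PSeries G (z ^ 2) * PSeries H (z ^ 2) = 1).
{ intros z Hz. destruct (Req_dec z 0) as [->|Hz0].
  - replace (0 ^ 2) with 0 by ring. rewrite !PSeries_0. unfold G, H, csch_ps.
    simpl. rewrite (bernoulli_0 b r HB). field.
  - pose proof (Hexp z Hz) as E1.
    pose proof (Hexp (- z) ltac:(rewrite Rabs_Ropp; exact Hz)) as E2.
    replace ((- z) ^ 2) with (z ^ 2) in E2 by ring.
    rewrite exp_Ropp in E2.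
    pose proof (PSeries_even_part _ z _ Hg Hz (csch_ps_odd b r HB)) as E3.
    fold G in E3. unfold csch_ps in E3.
    rewrite (PSeries_lin _ _ _ _ rho), PSeries_scale in E3 by auto.
    unfold rho in Hz.
    pose proof (Hgen z ltac:(lra)) as G1.
    pose proof (Hgen (2 * z) ltac:(rewrite Rabs_mult, (Rabs_pos_eq 2); lra)) as G2.
    rewrite exp_double in G2. pose proof (exp_neq_1 z Hz0) as Hn. pose proof (exp_pos z) as Hy.
    rewrite <- E3. set (h := PSeries H (z ^ 2)) in *.
    set (C := PSeries _ (z ^ 2)) in E1, E2.
    set (y := exp z) in *. set (u := PSeries b z) in *. set (v := PSeries b (2 * z)) in *.
    apply Rmult_eq_reg_r with (2 * z * y).
    2:{ repeat apply Rmult_integral_contrapositive_currified; lra. }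
    (* Subtracting the expansions at [z] and [- z] cancels the even part [C]: 2 z h = 2 sinh z = y -
       1 / y. *)
    assert (E4 : 2 * z * h * y = y * y - 1).
    { replace (2 * z * h) with (y - / y) by lra. field. lra. }
    transitivity ((2 * u + -1 * v) * (2 * z * h * y)); [ring|]. rewrite E4.
    transitivity (2 * (u * (y - 1)) * (y + 1) - v * (y * y - 1)); [ring|].
    rewrite G1, G2. ring. }
assert (HP : forall n, PS_mult G H n = delta0 n).
{ assert (0 < rho ^ 2) by (simpl; nra).
  apply (PS_sqr_coef _ _ (rho / 2)); [lra | | |].
  - apply geo_le with (rho ^ 2 / 2); [simpl; nra|]. now apply geo_PS_mult.
  - apply geo_delta0. simpl; nra.
  - intros z Hz. rewrite PSeries_delta0, PSeries_mult.
    + apply HGH. lra.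
    + apply geo_radius with (rho ^ 2); [exact HG | apply Hsq; lra].
    + apply geo_radius with (rho ^ 2); [exact HH | apply Hsq; lra]. }
assert (Hx2 : Rabs (- x ^ 2) < rho ^ 2).
{ rewrite Rabs_Ropp. apply Hsq. unfold rho. lra. }
replace (PSeries sin_n (x ^ 2)) with (PSeries H (- x ^ 2)).
2:{ replace (- x ^ 2) with (-1 * x ^ 2) by ring. rewrite <- PSeries_scale.
    apply PSeries_ext. intros n. reflexivity. }
rewrite <- PSeries_mult; [|eapply geo_radius; eauto | eapply geo_radius; eauto].
rewrite (PSeries_ext _ delta0) by exact HP. apply PSeries_delta0.
Qed.

(** Taylor coefficients of csc x - 1 / x. For k = 2m - 1 this is the coefficient of x^(2m) in x /
    sin x, that is, the one of z / sinh z with the sign (-1)^m from z^2 = - x^2. *)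
Definition csc_reg_ps (b : nat -> R) (k : nat) : R :=
  if Nat.even k then 0 else (-1) ^ S (Nat.div2 k) * csch_ps b (S k).

Lemma Derive_n_csc_reg_0 b r (HB : bernoulli_egf b r) k :
  Derive_n csc_reg k 0 = csc_reg_ps b k * INR (fact k).
Proof.
pose proof HB as (Hr & Hgeo & Hgen).
set (rho := r / 4). assert (Hrho : 0 < rho <= / 4) by (unfold rho; lra).
assert (Hg : geo (csch_ps b) rho).
{ apply geo_le with (r / 2); [unfold rho; lra|]. apply geo_lin; [lra | |].
  - apply geo_le with r; [lra | exact Hgeo].
  - apply geo_scale; [lra | rewrite Rabs_pos_eq; lra | exact Hgeo]. }
assert (Hq : geo (csc_reg_ps b) rho).
{ apply (geo_dom _ (PS_decr_1 (csch_ps b))); [lra | | now apply geo_decr].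
  intros n. unfold csc_reg_ps, PS_decr_1. destruct (Nat.even n).
  - rewrite Rabs_R0. apply Rabs_pos.
  - rewrite Rabs_mult, pow_1_abs. lra. }
set (G := fun n => csch_ps b (2 * n)).
assert (HG : geo G (rho ^ 2)) by (apply geo_even; [lra | exact Hg]).
rewrite (Derive_n_ext_loc _ (PSeries (csc_reg_ps b))).
{ apply Derive_n_coef. apply geo_radius_pos with rho; [lra | exact Hq]. }
exists (mkposreal rho (proj1 Hrho)). intros x Hx.
assert (Hxr : Rabs x < rho).
{ revert Hx. unfold ball; simpl; unfold AbsRing_ball, abs, minus, plus, opp; simpl.
  now rewrite Ropp_0, Rplus_0_r. }
clear Hx. pose proof (Rabs_pos x) as Hp.
assert (Hx2 : Rabs (x ^ 2) < rho ^ 2) by (rewrite <- RPow_abs; simpl; nra).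
assert (Eo : forall n, csc_reg_ps b (2 * n + 1) = -1 * ((-1) ^ n * PS_decr_1 G n)).
{ intros n. unfold csc_reg_ps, PS_decr_1, G. rewrite Nat.even_odd.
  replace (Nat.div2 (2 * n + 1)) with n by (rewrite Nat.add_1_r, Nat.div2_succ_double; reflexivity).
  replace (S (2 * n + 1)) with (2 * S n)%nat by lia. simpl pow. ring. }
assert (Ee : forall n, csc_reg_ps b (2 * n) = 0).
{ intros n. unfold csc_reg_ps. now rewrite Nat.even_even. }
assert (Hd : geo (PS_decr_1 G) (rho ^ 2)) by (apply geo_decr; [simpl; nra | exact HG]).
assert (Hds : ex_pseries (fun n => csc_reg_ps b (2 * n + 1)) (x ^ 2)).
{ apply (geo_ex_pseries _ (rho ^ 2)); [|exact Hx2].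
  apply (geo_dom _ (PS_decr_1 G)); [simpl; nra | | exact Hd].
  intros n. rewrite Eo, !Rabs_mult, pow_1_abs, (Rabs_left (-1)) by lra. lra. }
rewrite PSeries_odd_even; [| |exact Hds].
2:{ apply (ex_pseries_ext (fun _ => 0)); [intros; now rewrite Ee|].
    apply CV_radius_inside. now rewrite CV_radius_const_0. }
rewrite (PSeries_ext (fun n => csc_reg_ps b (2 * n)) (fun _ => 0) _ Ee), PSeries_const_0.
rewrite (PSeries_ext _ (PS_scal (-1) (fun n => (-1) ^ n * PS_decr_1 G n)) (x ^ 2)) by exact Eo.
rewrite PSeries_scal, PSeries_scale.
replace (-1 * x ^ 2) with (- x ^ 2) by ring.
pose proof (csch_sinc b r HB x Hxr) as E1. fold G in E1.
pose proof (PSeries_decr_1 G (- x ^ 2)) as E2.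
rewrite E2 in E1.
2:{ apply (geo_ex_pseries _ (rho ^ 2)); [exact HG | now rewrite Rabs_Ropp]. }
assert (G0 : G 0%nat = 1) by (unfold G, csch_ps; simpl; rewrite (bernoulli_0 b r HB); ring).
rewrite G0 in E1. unfold csc_reg.
destruct (Req_dec x 0) as [->|Hx0]; [ring|].
assert (Hs : PSeries sin_n (x ^ 2) <> 0) by (intros E; rewrite E in E1; lra).
pose proof (sinc_decr (x ^ 2)) as E3.
set (s := PSeries sin_n _) in *. set (d := PSeries (PS_decr_1 sin_n) _) in *.
set (g := PSeries (PS_decr_1 G) _) in *.
(* From (1 - x^2 g) s = 1 and s = 1 + x^2 d. Hence [csc_reg x], which is - x d / s, equals - x g. *)
assert (E4 : d = g * s).
{ apply Rmult_eq_reg_l with (x ^ 2); [|now apply pow_nonzero].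
  replace (x ^ 2 * d) with (s - 1) by lra. lra. }
rewrite E4. field. exact Hs.
Qed.

(** * The alternating harmonic series *)

Lemma ex_derive_n_Rinv k x : 0 < x -> ex_derive_n Rinv k x.
Proof.
intros Hx. apply (Cn_Derive_n k (fun y => 0 < y) Rinv); auto.
- apply open_gt.
- apply (Cn_inv k _ (fun y => y)); [intros; lra | apply Cn_id].
Qed.

Lemma Derive_n_Rinv k x : 0 < x ->
  Derive_n Rinv k x = (-1) ^ k * INR (fact k) * / x ^ S k.
Proof.
revert x; induction k as [|k IH]; intros x Hx.
- simpl. field. lra.
- simpl Derive_n.
  rewrite (Derive_ext_loc _ (fun y => (-1) ^ k * INR (fact k) * / y ^ S k)).
  2:{ apply (filter_imp (fun y => 0 < y)); [intros; now apply IH | now apply open_gt]. }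
  apply is_derive_unique.
  assert (x ^ k <> 0) by (apply pow_nonzero; lra).
  evar_last.
  { apply is_derive_scal, is_derive_inv; [|apply pow_nonzero; lra].
    apply (is_derive_pow (fun y => y) (S k) x 1), @is_derive_id. }
  rewrite fact_simpl, mult_INR. simpl pred. simpl pow. field. lra.
Qed.

(** Summation by parts: halving the weight of the last term leaves only increments and the initial
    value. It serves both the cosecant sum and the harmonic series. *)
Lemma alt_sum_increments (c : nat -> R) (j : nat) :
  (-1) ^ j * c j + 2 * psum (fun i => (-1) ^ i * c i) j
  = c 0%nat - psum (fun i => (-1) ^ i * (c (S i) - c i)) j.
Proof.
induction j as [|j IH]; [simpl; ring|]. cbn [psum]. simpl pow. lra.
Qed.

Lemma geom_alt x p : (1 + x) * psum (fun i => (-1) ^ i * x ^ i) p = 1 - (-1) ^ p * x ^ p.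
Proof. induction p as [|p IH]; simpl; [ring|]. rewrite Rmult_plus_distr_l, IH. ring. Qed.

(** As a function of y, the difference of the partial sum and ln (1 + y) has derivative -(-1)^p y^p
    / (1 + y), bounded by y^p on [0, 1]; integration gives 1 / (p + 1). *)
Lemma alt_harmonic_ln2 p :
  Rabs (psum (fun i => (-1) ^ i * / INR (S i)) p - ln 2) <= / INR (S p).
Proof.
assert (Hder : forall x, 0 <= x -> is_derive
  (fun y => psum (fun i => (-1) ^ i * / INR (S i) * y ^ S i) p - ln (1 + y)) x
  (- ((-1) ^ p * x ^ p) / (1 + x))).
{ intros x Hx.
  replace (- ((-1) ^ p * x ^ p) / (1 + x)) with (psum (fun i => (-1) ^ i * x ^ i) p - 1 / (1 + x)).
  2:{ pose proof (geom_alt x p). apply Rmult_eq_reg_l with (1 + x); [|lra]. field_simplify; lra. }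
  apply (is_derive_minus (K := R_AbsRing) (V := R_NormedModule)).
  - induction p as [|q IH]; cbn [psum]; [apply @is_derive_const|].
    apply (is_derive_plus (K := R_AbsRing) (V := R_NormedModule)); [exact IH|].
    evar_last.
    { apply is_derive_scal. apply (is_derive_pow (fun y => y) (S q) x 1), @is_derive_id. }
    rewrite Rmult_assoc. f_equal. simpl pred. field. apply not_0_INR. lia.
  - auto_derive; lra. }
assert (Hs : forall s, Rabs s = 1 ->
  s * (psum (fun i => (-1) ^ i * / INR (S i)) p - ln 2) <= / INR (S p)).
{ intros s Hs.
  set (phi := fun y => psum (fun i => (-1) ^ i * / INR (S i) * y ^ S i) p - ln (1 + y)) in *.
  (* The derivative of [psi] is nonnegative, so [psi 1 >= psi 0 = 0]; the two signs [s] give the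
     two-sided bound. *)
  set (psi := fun y => / INR (S p) * y ^ S p - s * phi y).
  destruct (MVT_gen psi 0 1 (fun x => x ^ p - s * (- ((-1) ^ p * x ^ p) / (1 + x)))) as (c & Hc & E).
  - rewrite Rmin_left, Rmax_right by lra. intros x Hx. unfold psi.
    apply (is_derive_minus (K := R_AbsRing) (V := R_NormedModule)).
    + evar_last.
      { apply is_derive_scal. apply (is_derive_pow (fun y => y) (S p) x 1), @is_derive_id. }
      simpl pred. field. apply not_0_INR. lia.
    + apply is_derive_scal, Hder. lra.
  - rewrite Rmin_left, Rmax_right by lra. intros x Hx.
    apply derivable_continuous_pt, ex_derive_Reals_0. unfold psi.
    apply (ex_derive_minus (K := R_AbsRing) (V := R_NormedModule)).
    + auto_derive. trivial.
    + eexists. apply is_derive_scal, Hder. lra.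
  - rewrite Rmin_left, Rmax_right in Hc by lra.
    assert (P0 : psi 0 = 0).
    { unfold psi, phi. rewrite Rplus_0_r, ln_1.
      rewrite (psum_ext _ (fun _ => 0 * 0)) by (intros; simpl; ring).
      rewrite psum_scal. simpl. ring. }
    assert (P1 : psi 1 = / INR (S p) - s * (psum (fun i => (-1) ^ i * / INR (S i)) p - ln 2)).
    { unfold psi, phi. rewrite pow1. replace (1 + 1) with 2 by ring.
      rewrite (psum_ext (fun i => _ * 1 ^ S i) (fun i => (-1) ^ i * / INR (S i)))
        by (intros; rewrite pow1; ring). ring. }
    rewrite P0, P1 in E. pose proof (pow_le c p ltac:(lra)) as Hcp.
    assert (Hb : Rabs (s * (- ((-1) ^ p * c ^ p) / (1 + c))) <= c ^ p).
    { unfold Rdiv. rewrite Rabs_mult, Hs, Rabs_mult, Rabs_Ropp, Rabs_mult, pow_1_abs.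
      rewrite (Rabs_pos_eq (c ^ p)) by assumption.
      assert (Hi : 0 < / (1 + c) <= 1).
      { split; [apply Rinv_0_lt_compat; lra|]. rewrite <- Rinv_1.
        apply Rinv_le_contravar; lra. }
      rewrite (Rabs_pos_eq (/ _)) by lra. nra. }
    apply Rabs_le_between in Hb. lra. }
apply Rabs_le. split.
- pose proof (Hs (-1) ltac:(rewrite Rabs_left; lra)). lra.
- pose proof (Hs 1 Rabs_R1). lra.
Qed.

Definition inv_increments (p : nat) : R :=
  psum (fun i => (-1) ^ i * (/ (1 + INR (S i)) - / (1 + INR i))) p.

(** This slow rate serves only to identify the limit; the sharp rate comes from Boole's formula. *)
Lemma inv_increments_lim p : Rabs (inv_increments p - (1 - 2 * ln 2)) <= 3 / (1 + INR p).
Proof.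
pose proof (alt_sum_increments (fun i => / (1 + INR i)) p) as E.
pose proof (alt_harmonic_ln2 p) as H.
rewrite (psum_ext _ (fun i => (-1) ^ i * / (1 + INR i))) in H
  by (intros; rewrite S_INR, Rplus_comm; reflexivity).
rewrite S_INR in H. cbv beta in E. fold (inv_increments p) in E.
replace (/ (1 + INR 0)) with 1 in E by (simpl; field).
set (X := psum _ p) in *.
replace (inv_increments p - (1 - 2 * ln 2))
  with (- ((-1) ^ p * / (1 + INR p)) + - (2 * (X - ln 2))) by lra.
pose proof (pos_INR p).
assert (0 < / (1 + INR p)) by (apply Rinv_0_lt_compat; lra).
eapply Rle_trans; [apply Rabs_triang|].
rewrite !Rabs_Ropp, !Rabs_mult, pow_1_abs, (Rabs_pos_eq (/ _)), (Rabs_pos_eq 2) by lra.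
rewrite (Rplus_comm (INR p) 1) in H. unfold Rdiv. lra.
Qed.

(** The factors are chosen so that summing over x = y, y + 1, ... telescopes to at most 2 y^(-K). *)
Lemma inv_pow_telescope (K : nat) (y x : R) : 0 < y <= x -> 1 <= x -> (1 <= K)%nat ->
  / x ^ S K <= / y ^ K * (2 * y) * (/ x - / (x + 1)).
Proof.
intros [Hy Hx] H HK.
destruct K as [|K]; [lia|].
assert (H1 : / x ^ K <= / y ^ K) by (apply Rinv_le_contravar; [now apply pow_lt | apply pow_incr; lra]).
assert (H2 : / (x * x) <= 2 * (/ x - / (x + 1))).
{ replace (2 * (/ x - / (x + 1))) with (/ (x * x) + (x - 1) / (x * x * (x + 1))) by (field; lra).
  assert (0 <= (x - 1) / (x * x * (x + 1))); [|lra].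
  apply Rmult_le_pos; [lra|]. apply Rlt_le, Rinv_0_lt_compat. nra. }
pose proof (pow_lt x K ltac:(lra)). pose proof (pow_lt y K ltac:(lra)).
replace (/ x ^ S (S K)) with (/ x ^ K * / (x * x)) by (simpl; field; lra).
replace (/ y ^ S K * (2 * y) * (/ x - / (x + 1))) with (/ y ^ K * (2 * (/ x - / (x + 1)))).
2:{ simpl. field. lra. }
apply Rmult_le_compat; auto; apply Rlt_le, Rinv_0_lt_compat; nra.
Qed.

(** The corrected sum [W p] changes at each step only by the error of [boole_step], of size (1 +
    p)^(-K-1). Summing these changes from [p] to infinity, where [W] has limit [1 - 2 * ln 2], gives
    the rate without any boundary term at [1]. *)
Lemma inv_increments_boole (t : nat -> R) (K : nat) : tanh_coef t -> (1 <= K)%nat ->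
  exists E, 0 <= E /\ forall p,
  Rabs (inv_increments p + (-1) ^ p * bdry t K Rinv 1 (1 + INR p) - (1 - 2 * ln 2))
  <= E / (1 + INR p) ^ K.
Proof.
intros Ht HK. destruct (boole_step t K Ht HK) as (C & HC & Hstep).
pose proof (lt_O_fact K) as HfK. apply lt_INR in HfK. simpl in HfK.
set (W p := inv_increments p + (-1) ^ p * bdry t K Rinv 1 (1 + INR p)).
assert (HW : forall p, Rabs (W (S p) - W p) <= C * INR (fact K) / (1 + INR p) ^ S K).
{ intros p. pose proof (pos_INR p) as Hp.
  assert (H := Hstep Rinv (1 + INR p) 1 (INR (fact K) / (1 + INR p) ^ S K) ltac:(lra)
    ltac:(intros y Hy k _; apply ex_derive_n_Rinv; lra)).
  assert (Hb : forall y, 1 + INR p <= y <= 1 + INR p + 1 ->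
    Rabs (Derive_n Rinv K y) <= INR (fact K) / (1 + INR p) ^ S K).
  { intros y Hy. rewrite Derive_n_Rinv by lra.
    rewrite !Rabs_mult, pow_1_abs, (Rabs_pos_eq (INR _)) by lra.
    assert (Hpy : 0 < y ^ S K) by (apply pow_lt; lra).
    rewrite Rabs_pos_eq by (apply Rlt_le, Rinv_0_lt_compat; exact Hpy).
    rewrite Rmult_1_l. apply Rmult_le_compat_l; [lra|].
    apply Rinv_le_contravar; [apply pow_lt; lra | apply pow_incr; lra]. }
  specialize (H Hb). rewrite pow1, Rmult_1_r in H.
  replace (1 + INR p + 1) with (1 + INR (S p)) in H by (rewrite S_INR; ring).
  unfold W, inv_increments. cbn [psum]. simpl pow.
  match goal with |- Rabs ?a <= _ => replace a with ((-1) ^ p *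
    (/ (1 + INR (S p)) - / (1 + INR p) - bdry t K Rinv 1 (1 + INR p)
     - bdry t K Rinv 1 (1 + INR (S p)))) by ring end.
  rewrite Rabs_mult, pow_1_abs, Rmult_1_l. unfold Rdiv in *. rewrite Rmult_assoc. exact H. }
set (D := C * INR (fact K)). assert (HD : 0 <= D) by (unfold D; apply Rmult_le_pos; lra).
assert (HWq : forall p q, Rabs (W (p + q)%nat - W p)
  <= D * (/ (1 + INR p) ^ K * (2 * (1 + INR p))) * (/ (1 + INR p) - / (1 + INR (p + q)))).
{ intros p q. pose proof (pos_INR p) as Hp. induction q as [|q IH].
  - rewrite Nat.add_0_r, !Rminus_diag, Rabs_R0. lra.
  - rewrite Nat.add_succ_r.
    replace (W (S (p + q)) - W p) with ((W (S (p + q)) - W (p + q)%nat) + (W (p + q)%nat - W p)) by ring.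
    eapply Rle_trans; [apply Rabs_triang|].
    pose proof (HW (p + q)%nat) as H1. fold D in H1.
    assert (Hpq : INR p <= INR (p + q)) by (apply le_INR; lia).
    pose proof (inv_pow_telescope K (1 + INR p) (1 + INR (p + q)) ltac:(lra) ltac:(lra) HK) as H2.
    apply (Rmult_le_compat_l D) in H2; [|exact HD].
    rewrite (S_INR (p + q)). replace (1 + (INR (p + q) + 1)) with (1 + INR (p + q) + 1) by ring.
    unfold Rdiv in H1. lra. }
set (F := psum (fun k => Rabs (t k) * INR (fact k)) K).
assert (Hlim : forall q, Rabs (W q - (1 - 2 * ln 2)) <= (3 + F) / (1 + INR q)).
{ intros q. pose proof (pos_INR q) as Hq. unfold W.
  match goal with |- Rabs ?a <= _ => replace a with ((inv_increments q - (1 - 2 * ln 2))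
    + (-1) ^ q * bdry t K Rinv 1 (1 + INR q)) by ring end.
  eapply Rle_trans; [apply Rabs_triang|].
  rewrite Rabs_mult, pow_1_abs, Rmult_1_l.
  unfold Rdiv. rewrite Rmult_plus_distr_r.
  apply Rplus_le_compat; [apply inv_increments_lim|].
  unfold F. rewrite Rmult_comm, <- psum_scal. apply psum_abs_le. intros k _.
  rewrite pow1, Rmult_1_r, Derive_n_Rinv by lra.
  rewrite !Rabs_mult, pow_1_abs, (Rabs_pos_eq (INR _)) by apply pos_INR.
  assert (Hpk : 1 <= (1 + INR q) ^ k) by (apply pow_R1_Rle; lra).
  rewrite (Rabs_pos_eq (/ _)) by (apply Rlt_le, Rinv_0_lt_compat; simpl; nra).
  assert (Hi : / (1 + INR q) ^ S k <= / (1 + INR q)).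
  { apply Rinv_le_contravar; [lra|]. simpl. nra. }
  pose proof (Rmult_le_pos _ _ (Rabs_pos (t k)) (pos_INR (fact k))).
  replace (/ (1 + INR q) * (Rabs (t k) * INR (fact k)))
    with (Rabs (t k) * INR (fact k) * / (1 + INR q)) by ring.
  rewrite Rmult_1_l, <- Rmult_assoc. now apply Rmult_le_compat_l. }
assert (HF : 0 <= F).
{ unfold F. eapply Rle_trans; [apply Rabs_pos|]. apply (psum_abs_le (fun k => Rabs (t k) * INR (fact k))).
  intros k _. rewrite Rabs_pos_eq; [lra|]. apply Rmult_le_pos; [apply Rabs_pos | apply pos_INR]. }
exists (2 * D). split; [lra|]. intros p. fold (W p). pose proof (pos_INR p) as Hp.
pose proof (pow_lt (1 + INR p) K ltac:(lra)) as HpK.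
apply le_epsilon. intros eps Heps.
(* This [q] makes the slow bound at [p + q] at most [eps]. *)
destruct (nfloor_ex ((3 + F) / eps)) as [q Hq].
{ apply Rmult_le_pos; [lra | apply Rlt_le, Rinv_0_lt_compat; lra]. }
assert (H1 := Hlim (p + q)%nat).
assert (H2 : (3 + F) / (1 + INR (p + q)) <= eps).
{ rewrite plus_INR. pose proof (pos_INR q).
  apply Rmult_le_reg_r with (1 + (INR p + INR q)); [lra|].
  unfold Rdiv. rewrite Rmult_assoc, Rinv_l, Rmult_1_r by lra.
  destruct Hq as [_ Hq]. apply (Rmult_lt_compat_r eps) in Hq; [|lra].
  unfold Rdiv in Hq. rewrite Rmult_assoc, Rinv_l, Rmult_1_r in Hq by lra.
  assert (0 <= eps * INR p) by (apply Rmult_le_pos; lra). lra. }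
assert (H3 := HWq p q).
replace (W p - (1 - 2 * ln 2)) with ((W (p + q)%nat - (1 - 2 * ln 2)) + - (W (p + q)%nat - W p)) by ring.
eapply Rle_trans; [apply Rabs_triang|]. rewrite Rabs_Ropp.
assert (H4 : D * (/ (1 + INR p) ^ K * (2 * (1 + INR p))) * (/ (1 + INR p) - / (1 + INR (p + q)))
  <= 2 * D / (1 + INR p) ^ K).
{ replace (2 * D / (1 + INR p) ^ K)
    with (D * (/ (1 + INR p) ^ K * (2 * (1 + INR p))) * / (1 + INR p)) by (field; lra).
  apply Rmult_le_compat_l.
  - apply Rmult_le_pos; [exact HD|]. apply Rmult_le_pos; [|lra].
    apply Rlt_le, Rinv_0_lt_compat, HpK.
  - pose proof (pos_INR (p + q)).
    assert (0 < / (1 + INR (p + q))) by (apply Rinv_0_lt_compat; lra). lra. }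
lra.
Qed.

(** * The cosecant sum *)

Lemma csc_reflect x : csc (PI - x) = csc x.
Proof. unfold csc. now rewrite sin_PI_x. Qed.

(** By reflection, [csc] is even about PI / 2. *)
Lemma Derive_n_csc_PI2 k : Nat.Odd k -> Derive_n csc k (PI / 2) = 0.
Proof.
intros [j ->]. set (k := (2 * j + 1)%nat).
assert (H : Derive_n (fun y => csc (- y + PI / 2)) k 0 = (-1) ^ k * Derive_n csc k (PI / 2)).
{ rewrite (Derive_n_comp_opp (fun y => csc (y + PI / 2))).
  - rewrite Derive_n_comp_trans. do 2 f_equal. ring.
  - rewrite Ropp_0. pose proof PI_RGT_0.
    assert (HU : open (fun y => - (PI / 2) < y < PI / 2)) by (apply open_and; [apply open_gt | apply open_lt]).
    apply (filter_imp (fun y => - (PI / 2) < y < PI / 2)); [|apply HU; lra].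
    intros y Hy i Hi.
    apply (ex_derive_n_ext (fun z => / cos z)).
    { intros z. unfold csc. now rewrite cos_sin, (Rplus_comm z). }
    apply (Cn_Derive_n k _ (fun z => / cos z) HU); auto.
    apply Cn_inv; [|apply Cn_sin]. intros z Hz. pose proof (cos_gt_0 z). lra. }
rewrite (Derive_n_ext _ (fun y => csc (y + PI / 2))), Derive_n_comp_trans, Rplus_0_l in H.
2:{ intros y. rewrite <- csc_reflect. f_equal. field. }
unfold k in H at 2. rewrite pow_add, pow_1_even in H. lra.
Qed.

Lemma Derive_n_csc_split k : Derive_n csc k (PI / 2)
  = Derive_n Rinv k (PI / 2) + Derive_n csc_reg k (PI / 2).
Proof.
pose proof PI_RGT_0.
assert (L : locally (PI / 2) (fun y => 0 < y < PI)).
{ apply (open_and _ _ (open_gt 0) (open_lt PI)). lra. }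
rewrite <- Derive_n_plus.
- apply Derive_n_ext_loc. revert L. apply filter_imp. intros y Hy. apply csc_split; lra.
- revert L. apply filter_imp. intros y Hy i _. apply ex_derive_n_Rinv. lra.
- revert L. apply filter_imp. intros y Hy i Hi.
  apply (Cn_Derive_n k near_zero csc_reg open_near_zero (csc_reg_Cn k)); [exact Hi|].
  unfold near_zero; lra.
Qed.

Lemma alt_csc_sum_psum n : (1 <= n)%nat -> alt_csc_sum n
  = psum (fun i => (-1) ^ i * csc (PI * INR (S i) / INR n)) (n - 1).
Proof.
intros Hn. unfold alt_csc_sum. rewrite psum_sum_n_m. apply psum_ext. intros i _.
rewrite Nat.add_1_r. simpl pow. ring.
Qed.

Lemma csc_node_reflect n i j : (1 <= n)%nat -> (S i + S j = n)%nat ->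
  csc (PI * INR (S j) / INR n) = csc (PI * INR (S i) / INR n).
Proof.
intros Hn H. rewrite <- csc_reflect. f_equal.
replace n with (S i + S j)%nat by lia. rewrite plus_INR.
pose proof (lt_0_INR (S i) ltac:(lia)). pose proof (lt_0_INR (S j) ltac:(lia)).
field. lra.
Qed.

(** The reflection l -> n - l preserves the cosecant and, for odd n, reverses the sign, so the sum
    equals its own negative. *)
Lemma alt_csc_sum_odd n : Nat.Odd n -> alt_csc_sum n = 0.
Proof.
intros [j ->]. rewrite alt_csc_sum_psum by lia.
set (n := (2 * j + 1)%nat). replace (n - 1)%nat with (2 * j)%nat by lia.
set (v := fun i => _).
assert (E : psum v (2 * j) = -1 * psum v (2 * j)); [|lra].
rewrite (psum_reverse v) at 1. rewrite <- psum_scal. apply psum_ext.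
intros i Hi. unfold v. rewrite (csc_node_reflect n i (2 * j - S i)) by lia.
rewrite <- Rmult_assoc. f_equal.
apply Rmult_eq_reg_r with ((-1) ^ i); [|apply pow_nonzero; lra].
rewrite Rmult_assoc, <- !pow_add.
replace (i + i)%nat with (2 * i)%nat by lia. rewrite pow_1_even.
replace (2 * j - S i + i)%nat with (2 * (j - 1) + 1)%nat by lia.
rewrite pow_add, pow_1_even. lra.
Qed.

(** For even n the reflection l -> n - l preserves signs; the sum folds about l = n / 2 = S j, which
    is counted once and so has half weight. *)
Lemma alt_csc_sum_increments j : let n := (2 * S j)%nat in
  alt_csc_sum n = csc (PI / INR n)
    - psum (fun i => (-1) ^ i * (csc (PI * INR (S (S i)) / INR n) - csc (PI * INR (S i) / INR n))) j.
Proof.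
intros n. rewrite alt_csc_sum_psum by lia.
replace (n - 1)%nat with (S (2 * j)) by lia.
rewrite psum_fold.
- rewrite (alt_sum_increments (fun i => csc (PI * INR (S i) / INR n))).
  simpl (INR 1). now rewrite Rmult_1_r.
- intros i Hi. rewrite (csc_node_reflect n i (2 * j - i)) by lia. f_equal.
  apply Rmult_eq_reg_r with ((-1) ^ i); [|apply pow_nonzero; lra].
  rewrite <- !pow_add. replace (i + i)%nat with (2 * i)%nat by lia.
  replace (2 * j - i + i)%nat with (2 * j)%nat by lia. now rewrite !pow_1_even.
Qed.

(** The term csc h contributes csc_reg(h) = csc_reg(h) - csc_reg(0), an additional increment from
    [0]. Hence the regular part has [S j] increments and the [/ x] part only [j]. *)
Lemma alt_csc_sum_split j : let h := PI / INR (2 * S j) in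
  alt_csc_sum (2 * S j) = / h * (1 - inv_increments j)
  + psum (fun l => (-1) ^ l * (csc_reg (0 + INR (S l) * h) - csc_reg (0 + INR l * h))) (S j).
Proof.
intros h. rewrite alt_csc_sum_increments.
pose proof PI_RGT_0 as HPI. pose proof (pos_INR j) as Hj.
assert (Hn : INR (2 * S j) = 2 * (INR j + 1)) by (rewrite mult_INR, (S_INR j); simpl; ring).
assert (Hh : 0 < h) by (unfold h; rewrite Hn; apply Rdiv_lt_0_compat; lra).
assert (HhS : h * (INR j + 1) = PI / 2) by (unfold h; rewrite Hn; field; lra).
assert (Hc : forall i, (i <= j)%nat -> csc (PI * INR (S i) / INR (2 * S j))
  = / h * / (1 + INR i) + csc_reg (0 + INR (S i) * h)).
{ intros i Hi. apply le_INR in Hi. pose proof (pos_INR i).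
  replace (PI * INR (S i) / INR (2 * S j)) with (0 + INR (S i) * h)
    by (unfold h; rewrite Hn; field; lra).
  rewrite S_INR, csc_split; [|nra|nra].
  f_equal. field. split; nra. }
pose proof (Hc 0%nat ltac:(lia)) as H0. simpl (INR 1) in H0. rewrite Rmult_1_r in H0.
rewrite H0.
rewrite (psum_ext (fun i => (-1) ^ i * (csc _ - csc _)) (fun i =>
  / h * ((-1) ^ i * (/ (1 + INR (S i)) - / (1 + INR i)))
  + -1 * ((-1) ^ S i * (csc_reg (0 + INR (S (S i)) * h) - csc_reg (0 + INR (S i) * h))))).
2:{ intros i Hi. rewrite !Hc by lia. simpl pow. ring. }
rewrite psum_lin, psum_head. fold (inv_increments j).
simpl (INR 0). rewrite Rmult_0_l, !Rplus_0_r, csc_reg_0. simpl (INR 1). simpl pow. 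
rewrite Rinv_1. ring.
Qed.

(** The two parts share the endpoint PI / 2 = h (1 + j). Homogeneity of [/ x] makes their boundary
    terms add up to those of [csc]: odd orders vanish there by symmetry, even orders because [t]
    does. *)
Lemma bdry_cancel (t : nat -> R) K j : (forall k, t (2 * k)%nat = 0) ->
  let h := PI / INR (2 * S j) in
  / h * bdry t K Rinv 1 (1 + INR j) + bdry t K csc_reg h (PI / 2) = 0.
Proof.
intros Ht h. pose proof PI_RGT_0 as HPI. pose proof (pos_INR j) as Hj.
assert (Hn : INR (2 * S j) = 2 * (INR j + 1)) by (rewrite mult_INR, (S_INR j); simpl; ring).
assert (Hh : 0 < h) by (unfold h; rewrite Hn; apply Rdiv_lt_0_compat; lra).
assert (HhS : PI / 2 = h * (1 + INR j)) by (unfold h; rewrite Hn; field; lra).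
rewrite <- (Rmult_1_l (bdry t K csc_reg _ _)). unfold bdry. rewrite <- psum_lin.
rewrite (psum_ext _ (fun _ => 0 * 0)); [rewrite psum_scal; ring|].
intros k _. destruct (Nat.Even_or_Odd k) as [[i ->]|Ho]; [rewrite Ht; ring|].
pose proof (Derive_n_csc_PI2 k Ho) as E. rewrite Derive_n_csc_split in E.
assert (E1 : h ^ k * Derive_n Rinv k (PI / 2) = / h * Derive_n Rinv k (1 + INR j)).
{ rewrite !Derive_n_Rinv by lra. rewrite HhS, Rpow_mult_distr.
  pose proof (pow_lt h k Hh). pose proof (pow_lt (1 + INR j) k ltac:(lra)).
  simpl pow. field. lra. }
rewrite pow1. replace (Derive_n csc_reg k (PI / 2)) with (- Derive_n Rinv k (PI / 2)) by lra.
transitivity (t k * (/ h * Derive_n Rinv k (1 + INR j) - h ^ k * Derive_n Rinv k (PI / 2))); [ring|].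
rewrite E1. ring.
Qed.

Lemma alt_csc_sum_boole (t : nat -> R) (K : nat) :
  tanh_coef t -> (forall k, t (2 * k)%nat = 0) ->
  exists A, forall n, (1 <= n)%nat -> Nat.Even n ->
  Rabs (alt_csc_sum n - (2 * INR n * ln 2 / PI + bdry t (S K) csc_reg (PI / INR n) 0))
  <= A / INR n ^ K.
Proof.
intros Ht Hev. pose proof PI_RGT_0 as HPI.
destruct (inv_increments_boole t (S K) Ht ltac:(lia)) as (E & HE & Hu).
destruct (boole_sum t (S K) Ht ltac:(lia)) as (C & HC & Hg).
assert (Hnz : forall y, 0 <= y <= PI / 2 -> near_zero y) by (unfold near_zero; intros; lra).
destruct (continuous_bounded (Derive_n csc_reg (S K)) 0 (PI / 2)) as (M & HM0 & HM).
{ intros x Hx. apply (Cn_Derive_n (S K) near_zero csc_reg open_near_zero (csc_reg_Cn _)); auto. }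
(* Obtained from h = PI / n, 1 + j = n / 2 and n / 2 steps for the regular part. *)
exists (E * 2 ^ S K / PI + C * PI ^ S K * M / 2).
intros n Hn1 [m Hm]. destruct m as [|j]; [lia|]. subst n.
rewrite alt_csc_sum_split.
set (h := PI / INR (2 * S j)). pose proof (pos_INR j) as Hj.
assert (Hn : INR (2 * S j) = 2 * (1 + INR j)) by (rewrite mult_INR, (S_INR j); simpl; ring).
assert (Hh : 0 < h) by (unfold h; rewrite Hn; apply Rdiv_lt_0_compat; lra).
assert (Hend : 0 + INR (S j) * h = PI / 2) by (unfold h; rewrite Hn, S_INR; field; lra).
assert (G := Hg csc_reg 0 h M (S j) Hh). rewrite Hend in G.
assert (G' := G ltac:(intros x Hx k Hk;
  apply (Cn_Derive_n (S K) near_zero csc_reg open_near_zero (csc_reg_Cn _)); auto) HM).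
clear G. pose proof (Hu j) as U. pose proof (bdry_cancel t (S K) j Hev) as X.
cbv zeta in X. fold h in X.
set (P := psum _ (S j)) in *. set (b0 := bdry t (S K) csc_reg h 0) in *.
set (b1 := bdry t (S K) csc_reg h (PI / 2)) in *.
set (bu := bdry t (S K) Rinv 1 (1 + INR j)) in *.
replace (2 * INR (2 * S j) * ln 2 / PI) with (/ h * (2 * ln 2))
  by (unfold h; rewrite Hn; field; lra).
assert (Hhi : 0 < / h) by now apply Rinv_0_lt_compat.
replace (/ h * (1 - inv_increments j) + P - (/ h * (2 * ln 2) + b0)) with
  (- (/ h * (inv_increments j + (-1) ^ j * bu - (1 - 2 * ln 2)))
   + (P - (b0 - (-1) ^ S j * b1)) + (-1) ^ j * (/ h * bu + b1)) by (simpl pow; ring).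
rewrite X, Rmult_0_r, Rplus_0_r.
eapply Rle_trans; [apply Rabs_triang|]. rewrite Rabs_Ropp, Rabs_mult, (Rabs_pos_eq (/ h)) by lra.
apply (Rmult_le_compat_l (/ h)) in U; [|lra].
assert (E1 : / h * (E / (1 + INR j) ^ S K) = E * 2 ^ S K / PI / INR (2 * S j) ^ K).
{ unfold h. rewrite Hn, Rpow_mult_distr.
  pose proof (pow_lt (1 + INR j) K ltac:(lra)). pose proof (pow_lt 2 K ltac:(lra)).
  simpl pow. field. lra. }
assert (E2 : INR (S j) * (C * h ^ S K * M) = C * PI ^ S K * M / 2 / INR (2 * S j) ^ K).
{ unfold h, Rdiv. rewrite Rpow_mult_distr, pow_inv.
  pose proof (pow_lt (INR (2 * S j)) K ltac:(lra)).
  rewrite (S_INR j), <- !tech_pow_Rmult.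
  replace (INR j + 1) with (INR (2 * S j) / 2) by lra. field. lra. }
rewrite E1 in U. rewrite E2 in G'. unfold Rdiv in *. rewrite Rmult_plus_distr_r. lra.
Qed.

(** Even orders vanish, and order 2r - 1 gives the term of index r = S i. One factor B_(2r) comes
    from tanh, the other from the Taylor coefficient of [csc_reg]. *)
Lemma bdry_csc_terms B r (HB : bernoulli_egf (fun n => B n / INR (fact n)) r) N n :
  (1 <= n)%nat ->
  bdry (tanh_ps (fun n => B n / INR (fact n))) (2 * N) csc_reg (PI / INR n) 0
  = 2 * psum (fun i => csc_term B n (S i)) N.
Proof.
intros Hn. apply le_INR in Hn. simpl in Hn.
unfold bdry. rewrite psum_pairs, <- psum_scal. apply psum_ext. intros i _.
rewrite (tanh_ps_even _ r HB), !Rmult_0_l, Rplus_0_l.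
rewrite (Derive_n_csc_reg_0 _ r HB). unfold csc_reg_ps. rewrite Nat.even_odd.
replace (Nat.div2 (2 * i + 1)) with i
  by (rewrite Nat.add_1_r, Nat.div2_succ_double; reflexivity).
unfold tanh_ps, csch_ps, csc_term.
replace (2 * S i - 1)%nat with (2 * i + 1)%nat by lia.
replace (2 * S i)%nat with (S (2 * i + 1)) by lia.
replace (delta0 (2 * i + 1)) with 0 by (rewrite Nat.add_1_r; reflexivity).
replace ((-1) ^ (S i + 1)) with ((-1) ^ S i * -1) by (rewrite pow_add; ring).
rewrite fact_simpl, mult_INR.
replace (INR (S (2 * i + 1))) with (2 * INR (S i))
  by (rewrite !S_INR, plus_INR, mult_INR; simpl; ring).
pose proof (INR_fact_neq_0 (2 * i + 1)). pose proof (lt_0_INR (S i) ltac:(lia)).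
unfold Rdiv. rewrite Rpow_mult_distr, pow_inv.
pose proof (pow_lt (INR n) (2 * i + 1) ltac:(lra)).
replace (2 ^ S (2 * i + 1)) with (2 * 2 ^ (2 * i + 1)) by reflexivity.
field. repeat split; lra.
Qed.

Lemma csc_term_bound B N n : (1 <= n)%nat ->
  Rabs (csc_term B n N) <= Rabs (csc_term B 1 N) / INR n ^ (2 * N - 1).
Proof.
intros Hn. apply le_INR in Hn. simpl in Hn.
pose proof (pow_lt (INR n) (2 * N - 1) ltac:(lra)) as Hp.
apply Req_le. unfold Rdiv. rewrite <- (Rabs_pos_eq (/ INR n ^ (2 * N - 1))).
2:{ apply Rlt_le, Rinv_0_lt_compat, Hp. }
rewrite <- Rabs_mult. f_equal. unfold csc_term, Rdiv.
simpl (INR 1). rewrite pow1, Rmult_1_r, !Rinv_mult. ring.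
Qed.

Theorem corollary2 :
  forall B : nat -> R, bernoulli_numbers B ->
    (forall N : nat, (2 <= N)%nat ->
       bigO_even (fun n => alt_csc_sum n - csc_expansion B N n)
                 (fun n => powerRZ (INR n) (1 - 2 * Z.of_nat N)))
    /\ (forall n : nat, (2 <= n)%nat -> Nat.Even n ->
          csc_expansion B 5 n
          = 2 * INR n * ln 2 / PI + PI / (12 * INR n)
            - 7 * PI ^ 3 / (1440 * INR n ^ 3)
            + 31 * PI ^ 5 / (30240 * INR n ^ 5)
            - 2159 * PI ^ 7 / (4838400 * INR n ^ 7))
    /\ bigO_even
         (fun n => alt_csc_sum n
          - (2 * INR n * ln 2 / PI + PI / (12 * INR n)
             - 7 * PI ^ 3 / (1440 * INR n ^ 3)
             + 31 * PI ^ 5 / (30240 * INR n ^ 5)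
             - 2159 * PI ^ 7 / (4838400 * INR n ^ 7)))
         (fun n => powerRZ (INR n) (-9))
    /\ (forall n : nat, (3 <= n)%nat -> Nat.Odd n -> alt_csc_sum n = 0).
Proof.
intros B HBern. destruct (bernoulli_egf_exists B HBern) as [r HB].
set (b := fun n => B n / INR (fact n)) in HB.
assert (Hmain : forall N, (2 <= N)%nat ->
  bigO_even (fun n => alt_csc_sum n - csc_expansion B N n)
            (fun n => powerRZ (INR n) (1 - 2 * Z.of_nat N))).
{ intros N HN.
  (* The error n^(1-2N) needs [2 * N] boundary orders, hence [N] terms; the surplus term of index
     [N] enters the constant below. *)
  destruct (alt_csc_sum_boole (tanh_ps b) (2 * N - 1) (tanh_ps_correct b r HB)
    (tanh_ps_even b r HB)) as [A HA].
  exists (A + 2 * Rabs (csc_term B 1 N)). exists 1%nat. intros n Hn Heven.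
  pose proof (HA n Hn Heven) as H. pose proof (csc_term_bound B N n Hn) as Ht.
  replace (S (2 * N - 1)) with (2 * N)%nat in H by lia.
  unfold b in H. rewrite (bdry_csc_terms B r HB N n Hn) in H.
  apply le_INR in Hn. simpl in Hn.
  replace (1 - 2 * Z.of_nat N)%Z with (- Z.of_nat (2 * N - 1))%Z by lia.
  rewrite powerRZ_neg', <- pow_powerRZ.
  rewrite (Rabs_pos_eq (/ _)) by (apply Rlt_le, Rinv_0_lt_compat, pow_lt; lra).
  unfold csc_expansion. rewrite psum_sum_n_m.
  destruct N as [|N]; [lia|]. cbn [psum] in H. replace (S N - 1)%nat with N by lia.
  set (s := psum _ N) in *. set (d := csc_term B n (S N)) in *.
  set (L := 2 * INR n * ln 2 / PI) in *.
  replace (alt_csc_sum n - (L + 2 * s))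
    with ((alt_csc_sum n - (L + 2 * (s + d))) + 2 * d) by ring.
  eapply Rle_trans; [apply Rabs_triang|].
  rewrite (Rabs_mult 2), (Rabs_pos_eq 2) by lra. unfold Rdiv in *. lra. }
assert (Hfive : forall n : nat, (2 <= n)%nat -> Nat.Even n ->
  csc_expansion B 5 n
  = 2 * INR n * ln 2 / PI + PI / (12 * INR n)
    - 7 * PI ^ 3 / (1440 * INR n ^ 3)
    + 31 * PI ^ 5 / (30240 * INR n ^ 5)
    - 2159 * PI ^ 7 / (4838400 * INR n ^ 7)).
{ intros n Hn _. apply le_INR in Hn. simpl in Hn.
  destruct (bernoulli_values b r HB) as (B2 & B4 & B6 & B8).
  unfold csc_expansion. simpl (5 - 1)%nat. rewrite psum_sum_n_m. cbn [psum].
  unfold csc_term.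
  assert (F : forall k, B k = b k * INR (fact k)).
  { intros k. unfold b. field. apply INR_fact_neq_0. }
  rewrite !F. simpl (2 * _)%nat. rewrite B2, B4, B6, B8.
  replace (INR (fact 2)) with 2 by (simpl; ring).
  assert (F4 : INR (fact 4) = 24) by (simpl; ring).
  assert (F6 : INR (fact 6) = 720) by (rewrite 2!fact_simpl, !mult_INR, F4; simpl; ring).
  assert (F8 : INR (fact 8) = 40320) by (rewrite 2!fact_simpl, !mult_INR, F6; simpl; ring).
  rewrite F4, F6, F8. simpl INR. simpl Nat.sub. simpl pow. field. split; [lra|apply PI_neq0]. }
split; [exact Hmain|]. split; [exact Hfive|]. split.
(* Four displayed corrections correspond to [N = 5], and 1 - 2 * 5 = -9. *)
- destruct (Hmain 5%nat ltac:(lia)) as [C [n0 H]]. exists C, (Nat.max 2 n0).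
  intros n Hn Heven. rewrite <- Hfive by (auto; lia). apply H; [lia | exact Heven].
- intros n _. apply alt_csc_sum_odd.
Qed.
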